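(* Let $n\ge 3$ and let $h_2:[n]\to[n]$ be the Hessenberg function $h_2=(2,n,\ldots,n)$, i.e. $h_2(1)=2$ and $h_2(j)=n$ for $2\le j\le n$. There is an isomorphism $$\mathrm{Hess}(N,h_2)\cap\Omega_e^\circ\;\cong\;\mathbb{C}^2/\mathfrak{C}_n\times\mathbb{C}^{\frac12(n-1)(n-2)-1}.$$
   Context: Write $[n]=\{1,\ldots,n\}$. $Fl(\mathbb{C}^n)$ is the variety of full flags $V_\bullet=(V_1\subset\cdots\subset V_n=\mathbb{C}^n)$, $\dim V_i=i$, identified with $\mathrm{GL}_n(\mathbb{C})/B$ ($B$ = upper triangular invertible matrices) by letting the first $j$ columns of $g$ span $V_j$. Let $N$ be the $n\times n$ nilpotent matrix consisting of a single Jordan block ($N_{i,i+1}=1$, all other entries $0$). For a nondecreasing $h:[n]\to[n]$ with $h(j)\ge j$ for all $j$ (a Hessenberg function), $$\mathrm{Hess}(N,h)=\{V_\bullet\in Fl(\mathbb{C}^n)\mid NV_i\subset V_{h(i)}\text{ for all }i\in[n]\},$$ a (reduced) closed subvariety. $\Omega_e^\circ$ is the opposite Schubert cell of the identity, i.e. the orbit of $eB$ under the group of lower triangular invertible matrices; it is an open affine subset of $Fl(\mathbb{C}^n)$, identified with the set of lower triangular unipotent $n\times n$ matrices. $\mathfrak{C}_n$ is the cyclic group of order $n$ generated by a primitive $n$-th root of unity $\zeta$, acting on $\mathbb{C}^2$ by $\zeta\cdot(x,y)=(\zeta x,\zeta^{-1}y)$; $\mathbb{C}^2/\mathfrak{C}_n$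 is the quotient variety (the cyclic quotient, or type $A_{n-1}$, singularity), with coordinate ring $\mathbb{C}[x,y]^{\mathfrak{C}_n}$. The isomorphism is one of algebraic varieties. *)

(* Defs.v *)
From HB Require Import structures.
From mathcomp Require Import all_boot all_order all_algebra.
From mathcomp Require Import boolp classical_sets reals.
From mathcomp Require Import complex.
From mathcomp Require Import mpoly.

Set Implicit Arguments.
Unset Strict Implicit.
Unset Printing Implicit Defensive.

Import GRing.Theory.

Local Open Scope ring_scope.
Local Open Scope classical_set_scope.

(* Varieties over an algebraically closed field K are treated as spaces with *)
(* functions, i.e. a set of points, its Zariski-open subsets, and, for U      *)
(* open, the functions regular on U.  A regular function on U is represented  *)
(* by a total function of which only the values on U matter; [regular U] is   *)
(* meaningful only for U open.                                                *)
Record space (K : closedFieldType) := Space {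
  point :> Type;
  is_open : set point -> Prop;
  regular : set point -> (point -> K) -> Prop }.

Section Spaces.
Variable K : closedFieldType.
Implicit Types X Y : space K.

Definition morphism X Y (f : X -> Y) : Prop :=
  forall U : set Y, is_open U ->
    is_open (f @^-1` U) /\
    forall phi : Y -> K, regular U phi -> regular (f @^-1` U) (phi \o f).

Definition isomorphic X Y : Prop :=
  exists (f : X -> Y) (g : Y -> X),
    [/\ morphism f, morphism g, cancel f g & cancel g f].

Definition affine_open m (U : set 'rV[K]_m) : Prop :=
  exists S : set {mpoly K[m]},
    U = [set v | exists2 p, S p & p.@[v 0] != 0].

Definition affine_regular m (U : set 'rV[K]_m) (f : 'rV[K]_m -> K) : Prop :=
  forall v, U v ->
    exists (W : set 'rV[K]_m) (p q : {mpoly K[m]}),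
      [/\ affine_open W, W v, W `<=` U &
          forall w, W w -> q.@[w 0] != 0 /\ f w = p.@[w 0] / q.@[w 0]].

Definition affine_space (m : nat) : space K :=
  Space (@affine_open m) (@affine_regular m).

(* Structure induced on T by an injection i into X; when i is the inclusion   *)
(* of a locally closed subset of a variety, this is its structure of reduced  *)
(* subvariety.                                                                *)
Definition induced X (T : Type) (i : T -> X) : space K :=
  @Space K T
    (fun W => exists2 U : set X, is_open U & W = i @^-1` U)
    (fun W f => forall t, W t ->
       exists (U : set X) (F : X -> K),
         [/\ is_open U, U (i t), regular U F &
             forall s, W s -> U (i s) -> f s = F (i s)]).

Definition subspace X (A : set X) : space K :=
  @induced X {x : X | A x} (@proj1_sig _ _).

(* Quotient structure on T along a surjection pi from X. *)
Definition coinduced X (T : Type) (pi : X -> T) : space K :=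
  @Space K T
    (fun U => is_open (pi @^-1` U))
    (fun U f => regular (pi @^-1` U) (f \o pi)).

(* Quotient of X by the cyclic group generated by a transformation s of X of  *)
(* finite order (so that the nonnegative iterates of s form the group): the   *)
(* points are the orbits, the regular functions are the invariant ones.       *)
Definition orbit_of X (s : X -> X) (x : X) : set X :=
  [set y | exists k : nat, y = iter k s x].

Definition orbit_space X (s : X -> X) : Type :=
  {A : set X | exists x, A = orbit_of s x}.

Definition orbit_proj X (s : X -> X) (x : X) : orbit_space s :=
  exist _ (orbit_of s x) (ex_intro _ x erefl).

Definition cyclic_quotient X (s : X -> X) : space K :=
  coinduced (@orbit_proj X s).

(* Product in the category of spaces with functions: regular functions are    *)
(* locally quotients of sums of products a(x) b(y), and the non-vanishing     *)
(* loci of such sums form a basis of the topology (which is in general finer  *)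
(* than the product topology).                                                *)
Definition tensor_regular X Y (U : set X) (V : set Y) (F : X -> Y -> K) :=
  exists (k : nat) (a : 'I_k -> X -> K) (b : 'I_k -> Y -> K),
    [/\ forall i, regular U (a i), forall i, regular V (b i) &
        forall x y, U x -> V y -> F x y = \sum_(i < k) a i x * b i y].

Definition product_open X Y (W : set (X * Y)) : Prop :=
  forall x y, W (x, y) ->
    exists (U : set X) (V : set Y) (F : X -> Y -> K),
      [/\ [/\ is_open U, U x, is_open V & V y],
          tensor_regular U V F, F x y != 0 &
          forall x' y', U x' -> V y' -> F x' y' != 0 -> W (x', y')].

Definition product_regular X Y (W : set (X * Y)) (f : X * Y -> K) : Prop :=
  forall x y, W (x, y) ->
    exists (U : set X) (V : set Y) (F G : X -> Y -> K),
      [/\ [/\ is_open U, U x, is_open V & V y],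
          tensor_regular U V F, tensor_regular U V G, G x y != 0 &
          forall x' y', U x' -> V y' -> G x' y' != 0 -> W (x', y') ->
            f (x', y') = F x' y' / G x' y'].

Definition product X Y : space K :=
  Space (@product_open X Y) (@product_regular X Y).

End Spaces.

Section Flags.
Variables (K : closedFieldType) (n : nat).

(* V i is the subspace of dimension i.+1: indices are shifted by one, the     *)
(* elements of 'I_n standing for 1, ..., n.                                   *)
Definition is_flag (V : {ffun 'I_n -> {vspace 'cV[K]_n}}) : bool :=
  [forall i, \dim (V i) == i.+1] &&
  [forall i : 'I_n, forall j : 'I_n, (i <= j)%N ==> (V i <= V j)%VS].

Definition flag : Type := {V : {ffun 'I_n -> {vspace 'cV[K]_n}} | is_flag V}.

Definition GL : Type := {g : 'M[K]_n | g \in unitmx}.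

Definition GL_space : space K :=
  @induced K (affine_space K (n * n)) GL (fun g => mxvec (val g)).

Definition col_span (g : 'M[K]_n) : {ffun 'I_n -> {vspace 'cV[K]_n}} :=
  [ffun j : 'I_n => <<[seq col i g | i : 'I_n <- enum 'I_n & (i <= j)%N]>>%VS].

Lemma col_spanP (g : GL) : is_flag (col_span (val g)).
Proof.
case: g => g /= ug; apply/andP; split; last first.
  apply/forallP => i; apply/forallP => j; apply/implyP => lij.
  rewrite !ffunE; apply: sub_span => v /mapP[k].
  rewrite mem_filter => /andP[lki _] ->; apply: map_f.
  by rewrite mem_filter (leq_trans lki lij) mem_enum.
have fr : free [seq col i g | i <- enum 'I_n].
  have E : [seq col i g | i <- enum 'I_n] = [tuple col i g | i < n] by [].
  rewrite E; apply/freeP => c c0.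
  have gc : g *m (\col_i c i) = 0.
    rewrite -[RHS]c0; apply/matrixP => a b; rewrite !mxE summxE.
    apply: eq_bigr => i _.
    by rewrite (nth_map i) ?size_enum_ord// nth_ord_enum !mxE mulrC.
  have {}gc : \col_i c i = 0.
    by rewrite -(mulKmx ug (\col_i c i)) gc mulmx0.
  by move=> i; have := congr1 (fun A : 'cV_n => A i 0) gc; rewrite !mxE.
apply/forallP => j; rewrite ffunE.
have frj : free [seq col i g | i : 'I_n <- enum 'I_n & (i <= j)%N].
  move: fr; rewrite -(perm_free (perm_map (fun i => col i g) (permEl (perm_filterC
    (fun i : 'I_n => (i <= j)%N) (enum 'I_n))))).
  by rewrite map_cat => /catl_free.
move: frj; rewrite /free => /eqP ->; rewrite size_map.
rewrite size_filter -(count_map val (fun i => i <= j)%N) val_enum_ord.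
have -> : iota 0 n = iota 0 (j.+1 + (n - j.+1)) by rewrite subnKC.
rewrite iotaD count_cat.
rewrite (_ : count _ _ = j.+1); last first.
  rewrite -[RHS](size_iota 0); apply/eqP; rewrite -all_count; apply/allP => k.
  by rewrite mem_iota add0n ltnS.
rewrite (_ : count _ _ = 0)%N ?addn0//; apply/eqP.
rewrite -leqn0 leqNgt -has_count; apply/hasPn => k.
by rewrite mem_iota add0n -ltnNge => /andP[].
Qed.

Definition col_flag (g : GL) : flag := exist _ (col_span (val g)) (col_spanP g).

(* GL_n / B, whose points are identified with flags: g B and g' B coincide    *)
(* exactly when col_flag g = col_flag g'.                                     *)
Definition flag_variety : space K := @coinduced K GL_space flag col_flag.

Definition jordan_block : 'M[K]_n :=
  \matrix_(i < n, j < n) (j == i.+1 :> nat)%:R.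

Definition Hess (A : 'M[K]_n) (h : 'I_n -> 'I_n) : set flag_variety :=
  [set V : flag |
    forall i, (linfun (mulmx A) @: val V i <= val V (h i))%VS].

(* The orbit { b B | b lower triangular invertible } of eB. *)
Definition opposite_cell : set flag_variety :=
  [set V : flag | exists2 b : GL, is_trig_mx (val b) & V = col_flag b].

End Flags.

Arguments opposite_cell K n : clear implicits.

(* The Hessenberg function (2, n, ..., n), with indices shifted by one; the   *)
(* default value of insubd is not used when n >= 2, see h2E.                  *)
Definition h2 (n : nat) (j : 'I_n) : 'I_n :=
  insubd j (if j == 0 :> nat then 1 else n.-1)%N.

Lemma h2E (n : nat) (j : 'I_n) : (1 < n)%N ->
  h2 j = (if j == 0 :> nat then 1 else n.-1)%N :> nat.
Proof.
case: n j => // n j n1; rewrite val_insubd /=.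
by case: (j == 0 :> nat); rewrite ?n1 ?leqnn.
Qed.

(* (x, y) |-> (zeta x, zeta^-1 y). *)
Definition cyclic_act (K : closedFieldType) (zeta : K) (v : 'rV[K]_2) :
  'rV[K]_2 :=
  \row_(i < 2) (if i == 0 then zeta * v 0 i else zeta^-1 * v 0 i).

Definition cyclic_singularity (K : closedFieldType) (zeta : K) : space K :=
  @cyclic_quotient K (affine_space K 2) (cyclic_act zeta).

(* Main.v *)
From HB Require Import structures.
From mathcomp Require Import all_boot all_order all_algebra.
From mathcomp Require Import boolp classical_sets reals.
From mathcomp Require Import complex.
From mathcomp Require Import mpoly.
From mathcomp Require Import ring zify.
Require Import Defs.

(** A flag in the opposite cell is given by a unique lower unitriangular
    matrix u.  Number rows and columns from 0, and let a and b be the first two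
    columns of u.  For h_2 only V_1 carries a condition: N a must be a
    combination of a and b.  Rows 0 and 1 force the two coefficients to be
    x = a_1 and c = a_2 - a_1^2, so the condition is the recurrence
      a_(k+1) = x a_k + c b_k   (k < n, with a_n = 0),
    whose solution is a_k = x^k + c s_k with s_(k+1) = x s_k + b_k, s_0 = 0.
    The entries of a are thus determined by x, c and b, and the last equation,
    a_n = 0, reads x^n = c t with t = - s_n.  Since s_n is b_(n-1) plus an
    expression in x, b_1, ..., b_(n-2), the coordinate t can replace b_(n-1).
    Hence the variety is the surface x^n = c t times the affine space of the
    remaining entries of u below the diagonal
    ([Hess_unitriangular], [cell_matrix_coords]).

    That surface is the quotient of the plane by the cyclic group: send (p, q)
    to (p q, p^n, q^n).  Two points have the same image exactly when they lie
    on one orbit ([invariants_orbit]), every point of the surface is reached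
    ([invariants_surj]), and, locally, invariant regular functions are
    quotients of polynomials in the three invariants ([regular_invariant]).
    For the latter, let phi be an invariant regular function on an open set,
    and write phi Q = P there with Q nonzero at v ([affine_regularP]).  Decompose
    P and Q into weight components for the group.  Averaging shows that
    phi Q_i = P_i for each weight i; some Q_i is nonzero at v, and Q_i^n is an
    invariant denominator.

    It remains to see that both bijections are morphisms of spaces with
    functions.  A map into an affine space, a subspace, a product or the cyclic
    quotient is a morphism as soon as its coordinates (invariants, for the
    quotient) are regular, provided that the source is a space on which regular
    functions form a sheaf of rings with inverses of nowhere vanishing functions
    ([sheaf_of_functions]); this property passes to induced, coinduced and
    product spaces.  The entries of u are regular functions of the flag because
    they are quotients of minors of any matrix representing the flag
    ([chart_value_col_flag]). *)

Set Implicit Arguments.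
Unset Strict Implicit.
Unset Printing Implicit Defensive.

Import GRing.Theory.

Local Open Scope ring_scope.
Local Open Scope classical_set_scope.

(** * Spaces with functions and morphisms between them *)

Section Sheaves.
Variable K : closedFieldType.
Implicit Types X Y Z : space K.

(** The record [space] only stores data; these are the axioms of a space
    with functions, from which the morphism criteria below follow. *)
Record sheaf_of_functions X : Prop := SheafOfFunctions {
  openT : is_open (@setT X);
  openI : forall U V : set X, is_open U -> is_open V -> is_open (U `&` V);
  open_locally : forall U : set X,
    (forall x, U x -> exists V, [/\ is_open V, V x & V `<=` U]) -> is_open U;
  regular_sub : forall (U V : set X) f, is_open U -> is_open V -> V `<=` U ->
    regular U f -> regular V f;
  regular_locally : forall (U : set X) f, is_open U ->
    (forall x, U x -> exists V g, [/\ is_open V, V x, regular V g &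
       forall y, U y -> V y -> f y = g y]) -> regular U f;
  regular_cst : forall (U : set X) a, is_open U -> regular U (fun=> a);
  regularD : forall (U : set X) f g, is_open U ->
    regular U f -> regular U g -> regular U (fun x => f x + g x);
  regularM : forall (U : set X) f g, is_open U ->
    regular U f -> regular U g -> regular U (fun x => f x * g x);
  open_neq0 : forall (U : set X) f, is_open U -> regular U f ->
    is_open (U `&` [set x | f x != 0]);
  regularV : forall (U : set X) f, is_open U -> regular U f ->
    regular (U `&` [set x | f x != 0]) (fun x => (f x)^-1) }.

Section SheafTheory.
Variables (X : space K) (sX : sheaf_of_functions X).

Lemma eq_regular (U : set X) f g : is_open U ->
  (forall x, U x -> f x = g x) -> regular U g -> regular U f.
Proof.
move=> oU fg rg; apply: (regular_locally sX) => // x Ux.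
by exists U, g; split=> // y Uy _; apply: fg.
Qed.

Lemma open_neq0_locally (U : set X) :
  (forall x, U x -> exists V f, [/\ is_open V, V x, regular V f, f x != 0 &
     forall y, V y -> f y != 0 -> U y]) -> is_open U.
Proof.
move=> h; apply: (open_locally sX) => x /h[V [f [oV Vx rf fx sub]]].
exists (V `&` [set y | f y != 0]); split=> //; first exact: (open_neq0 sX).
by move=> y [Vy fy]; apply: sub.
Qed.

(** The form in which regularity is checked later: the local denominator q
    need only be nonzero at the given point, because the locus where it does
    not vanish is again open. *)
Lemma regular_fraction (U : set X) f : is_open U ->
  (forall x, U x -> exists V p q, [/\ is_open V, V x, regular V p, regular V q &
     q x != 0 /\ forall y, U y -> V y -> f y * q y = p y]) -> regular U f.
Proof.
move=> oU h; apply: (regular_locally sX) => // x /h[V [p [q]]].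
case=> oV Vx rp rq [qx fqp]; have oV' := open_neq0 sX oV rq.
exists (V `&` [set y | q y != 0]), (fun y => p y * (q y)^-1); split=> //.
- apply: (regularM sX) => //; last exact: (regularV sX).
  by apply: (regular_sub sX) oV _ _ rp => // y [].
- by move=> y Uy [Vy qy]; rewrite -(fqp y Uy Vy) mulfK.
Qed.

Lemma regular_sum (U : set X) I (r : seq I) (P : pred I) (F : I -> X -> K) :
  is_open U -> (forall i, P i -> regular U (F i)) ->
  regular U (fun x => \sum_(i <- r | P i) F i x).
Proof.
move=> oU rF; elim: r => [|i r IH].
  by apply: eq_regular (regular_cst sX 0 oU) => // x _; rewrite big_nil.
have [Pi|nPi] := boolP (P i).
  apply: eq_regular (regularD sX oU (rF _ Pi) IH) => // x _.
  by rewrite big_cons Pi.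
by apply: eq_regular IH => // x _; rewrite big_cons (negPf nPi).
Qed.

Lemma regular_prod (U : set X) I (r : seq I) (P : pred I) (F : I -> X -> K) :
  is_open U -> (forall i, P i -> regular U (F i)) ->
  regular U (fun x => \prod_(i <- r | P i) F i x).
Proof.
move=> oU rF; elim: r => [|i r IH].
  by apply: eq_regular (regular_cst sX 1 oU) => // x _; rewrite big_nil.
have [Pi|nPi] := boolP (P i).
  apply: eq_regular (regularM sX oU (rF _ Pi) IH) => // x _.
  by rewrite big_cons Pi.
by apply: eq_regular IH => // x _; rewrite big_cons (negPf nPi).
Qed.

Lemma regularN (U : set X) f : is_open U ->
  regular U f -> regular U (fun x => - f x).
Proof.
move=> oU rf; apply: eq_regular (regularM sX oU (regular_cst sX (-1) oU) rf) => //.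
by move=> x _; rewrite mulN1r.
Qed.

Lemma regularB (U : set X) f g : is_open U ->
  regular U f -> regular U g -> regular U (fun x => f x - g x).
Proof. by move=> oU rf rg; apply: (regularD sX) => //; apply: regularN. Qed.

Lemma regularX (U : set X) f k : is_open U ->
  regular U f -> regular U (fun x => f x ^+ k).
Proof.
move=> oU rf; elim: k => [|k IH]; first exact: (regular_cst sX).
by apply: eq_regular (regularM sX oU rf IH) => // x _; rewrite exprS.
Qed.

Lemma regular_det (U : set X) k (A : X -> 'M[K]_k) : is_open U ->
  (forall i j, regular U (fun x => A x i j)) -> regular U (fun x => \det (A x)).
Proof.
move=> oU rA; apply: regular_sum => // s _; apply: (regularM sX) => //.
  exact: (regular_cst sX).
by apply: regular_prod.
Qed.

Lemma regular_meval (U : set X) m (h : X -> 'rV[K]_m) (p : {mpoly K[m]}) :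
  is_open U -> (forall i, regular U (fun x => h x 0 i)) ->
  regular U (fun x => p.@[h x 0]).
Proof.
move=> oU rh; apply: (@eq_regular _ _ (fun x =>
    \sum_(mm <- msupp p) p@_mm * \prod_(i < m) h x 0 i ^+ mm i)) => //.
apply: regular_sum => [//|mm _]; apply: (regularM sX) => //.
  exact: (regular_cst sX).
by apply: regular_prod => [//|i _]; apply: regularX.
Qed.

End SheafTheory.

Lemma affine_openP m (U : set 'rV[K]_m) :
  affine_open U <-> forall v, U v -> exists2 p : {mpoly K[m]}, p.@[v 0] != 0 &
    forall w : 'rV[K]_m, p.@[w 0] != 0 -> U w.
Proof.
split=> [[S ->] v [p Sp pv]|h]; first by exists p => // w pw; exists p.
exists [set p : {mpoly K[m]} | forall w : 'rV[K]_m, p.@[w 0] != 0 -> U w].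
apply/seteqP; split=> v /=.
  by move=> /h[p]; exists p.
by move=> [p pU pv]; apply: pU.
Qed.

(** Regularity on U is local, but its fractions can be chosen so that
    f q = p holds on the whole of U: if f = p / q on the non-vanishing locus of
    r, then f (q r) = p r holds there, and both sides vanish elsewhere.  Such
    identities, unlike local fractions, can be averaged over a group. *)
Lemma affine_regularP m (U : set 'rV[K]_m) f : affine_open U ->
  (affine_regular U f <-> forall v, U v -> exists p q : {mpoly K[m]},
    q.@[v 0] != 0 /\ forall w : 'rV[K]_m, U w -> f w * q.@[w 0] = p.@[w 0]).
Proof.
move=> oU; split=> h v Uv.
  have [W [p [q [/affine_openP oW Wv WU fE]]]] := h v Uv.
  have [r rv rW] := oW v Wv.
  exists (p * r), (q * r); split.
    by rewrite mevalM mulf_neq0//; case: (fE v Wv).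
  move=> w Uw; rewrite !mevalM; have [->|rw] := eqVneq r.@[w 0] 0.
    by rewrite !mulr0.
  have [qw ->] := fE w (rW w rw).
  by rewrite mulrA divfK.
have [p [q [qv fE]]] := h v Uv; have [r rv rU] := (affine_openP U).1 oU v Uv.
exists [set w : 'rV[K]_m | (q * r).@[w 0] != 0], p, q; split.
- by apply/affine_openP => w qw; exists (q * r).
- by rewrite /= mevalM mulf_neq0.
- by move=> w /=; rewrite mevalM mulf_eq0 negb_or => /andP[_ /rU].
- move=> w /=; rewrite mevalM mulf_eq0 negb_or => /andP[qw /rU Uw].
  by rewrite -fE// mulfK.
Qed.

Lemma affine_sheaf m : sheaf_of_functions (affine_space K m).
Proof.
have oN (U : set 'rV[K]_m) f : affine_open U -> affine_regular U f ->
    affine_open (U `&` [set x | f x != 0]).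
  move=> oU /(affine_regularP f oU) rf; apply/affine_openP => v [Uv /= fv].
  have [p [q [qv fE]]] := rf v Uv.
  have [r rv rU] := (affine_openP U).1 oU v Uv.
  exists (p * r) => [|w]; first by rewrite mevalM mulf_neq0// -fE// mulf_neq0.
  rewrite mevalM mulf_eq0 negb_or => /andP[pw /rU Uw]; split=> //=.
  by apply: contraNneq pw => f0; rewrite -fE// f0 mul0r.
split=> /=.
- by apply/affine_openP => v _; exists 1; rewrite ?meval1 ?oner_neq0.
- move=> U V /affine_openP oU /affine_openP oV; apply/affine_openP => v [].
  move=> /oU[p pv pU] /oV[q qv qV]; exists (p * q).
    by rewrite mevalM mulf_neq0.
  by move=> w; rewrite mevalM mulf_eq0 negb_or => /andP[/pU ? /qV].
- move=> U h; apply/affine_openP => v /h[V [/affine_openP oV Vv VU]].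
  by have [p pv pV] := oV v Vv; exists p => // w /pV/VU.
- move=> U V f oU oV VU /(affine_regularP f oU) rf.
  apply/affine_regularP => // v /VU/rf[p [q [qv fE]]].
  by exists p, q; split=> // w /VU; apply: fE.
- move=> U f oU h v Uv; have [V [g [oV Vv rg fg]]] := h v Uv.
  have [W [p [q [oW Wv WV gE]]]] := rg v Vv.
  have [r rv rW] := (affine_openP W).1 oW v Wv.
  have [s sv sU] := (affine_openP U).1 oU v Uv.
  exists [set w : 'rV[K]_m | (r * s).@[w 0] != 0], p, q; split.
  + by apply/affine_openP => w qw; exists (r * s).
  + by rewrite /= mevalM mulf_neq0.
  + by move=> w /=; rewrite mevalM mulf_eq0 negb_or => /andP[_ /sU].
  + move=> w /=; rewrite mevalM mulf_eq0 negb_or => /andP[/rW Ww /sU Uw].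
    by have [qw gw] := gE w Ww; split=> //; rewrite fg//; apply: WV.
- move=> U a oU; apply/affine_regularP => // v _.
  exists a%:MP, 1; rewrite meval1 oner_neq0; split=> // w _.
  by rewrite meval1 mevalC mulr1.
- move=> U f g oU /(affine_regularP _ oU) rf /(affine_regularP _ oU) rg.
  apply/affine_regularP => // v Uv.
  have [p [q [qv fE]]] := rf v Uv; have [p' [q' [qv' gE]]] := rg v Uv.
  exists (p * q' + p' * q), (q * q'); rewrite mevalM mulf_neq0//; split=> // w Uw.
  rewrite mevalD !mevalM -fE// -gE//; ring.
- move=> U f g oU /(affine_regularP _ oU) rf /(affine_regularP _ oU) rg.
  apply/affine_regularP => // v Uv.
  have [p [q [qv fE]]] := rf v Uv; have [p' [q' [qv' gE]]] := rg v Uv.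
  exists (p * p'), (q * q'); rewrite mevalM mulf_neq0//; split=> // w Uw.
  rewrite !mevalM -fE// -gE//; ring.
- exact: oN.
- move=> U f oU rf; apply/affine_regularP; first exact: oN.
  move=> v [Uv /= fv]; have [p [q [qv fE]]] := (affine_regularP f oU).1 rf v Uv.
  exists q, p; split=> [|w [Uw /= fw]]; first by rewrite -fE// mulf_neq0.
  by rewrite -fE// mulKf.
Qed.

(** Each axiom is local on T, where a regular function is the
    restriction of a regular function of X. *)
Lemma induced_sheaf X (T : Type) (i : T -> X) :
  sheaf_of_functions X -> sheaf_of_functions (induced i).
Proof.
move=> sX; have oN (W : set T) f : @is_open _ (induced i) W ->
   @regular _ (induced i) W f -> @is_open _ (induced i) (W `&` [set x | f x != 0]).
  move=> [U0 oU0 ->] rf.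
  (* the largest open set whose trace on T lies in the wanted locus *)
  exists [set x | exists U : set X, [/\ is_open U, U x &
     forall s, U (i s) -> (i @^-1` U0) s /\ f s != 0]].
    apply: (open_locally sX) => x [U [oU Ux h]]; exists U; split=> // y Uy.
    by exists U.
  apply/seteqP; split=> t /=; last by move=> [U [oU Ut h]]; apply: h.
  move=> [U0t ft]; have [U [F [oU Ut rF fF]]] := rf t U0t.
  exists (U0 `&` (U `&` [set x | F x != 0])); split=> //.
  - by apply: (openI sX) => //; apply: (open_neq0 sX).
  - by split=> //; split=> //=; rewrite -fF.
  - by move=> s [U0s [Us /= Fs]]; split=> //; rewrite fF.
split=> /=.
- by exists setT => //; apply: openT.
- move=> _ _ [U oU ->] [V oV ->]; exists (U `&` V) => //; exact: openI.
- move=> W h.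
  exists [set x | exists U : set X, [/\ is_open U, U x & i @^-1` U `<=` W]].
    apply: (open_locally sX) => x [U [oU Ux UW]]; exists U; split=> // y Uy.
    by exists U.
  apply/seteqP; split=> t /=; last by move=> [U [oU Ut]]; apply.
  by move=> /h[_ [[U oU ->] Ut UW]]; exists U.
- move=> W V f _ _ VW rf t Vt; have [U [F [oU Ut rF fF]]] := rf t (VW t Vt).
  by exists U, F; split=> // s /VW; apply: fF.
- move=> W f _ h t Wt; have [_ [g [[U oU ->] Ut rg fg]]] := h t Wt.
  have [U' [F [oU' Ut' rF gF]]] := rg t Ut.
  have oUU := openI sX oU oU'.
  exists (U `&` U'), F; split=> //.
    by apply: (regular_sub sX) oU' _ _ rF => // x [].
  by move=> s Ws [Us Us']; rewrite fg// gF.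
- move=> W a _ t Wt; exists setT, (fun=> a).
  by split=> //; [exact: openT | apply: (regular_cst sX); apply: openT].
- move=> W f g _ rf rg t Wt.
  have [U [F [oU Ut rF fF]]] := rf t Wt; have [V [G [oV Vt rG gG]]] := rg t Wt.
  have oUV := openI sX oU oV.
  exists (U `&` V), (fun x => F x + G x); split=> //; last first.
    by move=> s Ws [Us Vs]; rewrite fF// gG.
  apply: (regularD sX) => //.
    by apply: (regular_sub sX) oU _ _ rF => // x [].
  by apply: (regular_sub sX) oV _ _ rG => // x [].
- move=> W f g _ rf rg t Wt.
  have [U [F [oU Ut rF fF]]] := rf t Wt; have [V [G [oV Vt rG gG]]] := rg t Wt.
  have oUV := openI sX oU oV.
  exists (U `&` V), (fun x => F x * G x); split=> //; last first.
    by move=> s Ws [Us Vs]; rewrite fF// gG.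
  apply: (regularM sX) => //.
    by apply: (regular_sub sX) oU _ _ rF => // x [].
  by apply: (regular_sub sX) oV _ _ rG => // x [].
- exact: oN.
- move=> W f _ rf t [Wt /= ft]; have [U [F [oU Ut rF fF]]] := rf t Wt.
  exists (U `&` [set x | F x != 0]), (fun x => (F x)^-1); split.
  + exact: open_neq0.
  + by split=> //=; rewrite -fF.
  + exact: regularV.
  + by move=> s [Ws _] [Us _]; rewrite fF.
Qed.

Lemma coinduced_sheaf X (T : Type) (pi : X -> T) :
  sheaf_of_functions X -> sheaf_of_functions (coinduced pi).
Proof.
move=> sX; split=> /=.
- exact: openT.
- by move=> U V; apply: openI.
- move=> U h; apply: (open_locally sX) => x /= /h[V [oV Vx VU]].
  by exists (pi @^-1` V); split=> // y /=; apply: VU.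
- move=> U V f oU oV VU; apply: (regular_sub sX) => // x; exact: VU.
- move=> U f oU h; apply: (regular_locally sX) => // x /= /h[V [g [oV Vx rg fg]]].
  by exists (pi @^-1` V), (g \o pi); split=> // y /=; apply: fg.
- by move=> U a; apply: (regular_cst sX).
- by move=> U f g oU rf rg; apply: (regularD sX oU rf rg).
- by move=> U f g oU rf rg; apply: (regularM sX oU rf rg).
- by move=> U f oU rf; apply: (open_neq0 sX oU rf).
- by move=> U f oU rf; apply: (regularV sX oU rf).
Qed.

Section TensorRegular.
Variables (X Y : space K) (sX : sheaf_of_functions X) (sY : sheaf_of_functions Y).
Variables (U : set X) (V : set Y).
Hypotheses (oU : is_open U) (oV : is_open V).

Lemma tensor_regular_fin (I : finType) (a : I -> X -> K) (b : I -> Y -> K) F :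
  (forall i, regular U (a i)) -> (forall i, regular V (b i)) ->
  (forall x y, U x -> V y -> F x y = \sum_i a i x * b i y) ->
  tensor_regular U V F.
Proof.
move=> ra rb FE.
exists #|I|, (fun k => a (enum_val k)), (fun k => b (enum_val k)).
split=> // x y Ux Vy; rewrite FE// (reindex (@enum_val I I)) //=.
by apply: onW_bij; apply: enum_val_bij.
Qed.

Lemma tensor_regular_pure a b : regular U a -> regular V b ->
  tensor_regular U V (fun x y => a x * b y).
Proof.
move=> ra rb; apply: (@tensor_regular_fin unit (fun=> a) (fun=> b)) => // x y _ _.
by rewrite big_const card_unit /= addr0.
Qed.

Lemma tensor_regular_cst (a : K) : tensor_regular U V (fun _ _ => a).
Proof.
have [k [p [q [rp rq E]]]] := tensor_regular_pure
  (regular_cst sX a oU) (regular_cst sY 1 oV).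
by exists k, p, q; split=> // x y Ux Vy; rewrite -E// mulr1.
Qed.

Lemma tensor_regularD F G : tensor_regular U V F -> tensor_regular U V G ->
  tensor_regular U V (fun x y => F x y + G x y).
Proof.
move=> [k [a [b [ra rb FE]]]] [l [c [d [rc rd GE]]]].
apply: (@tensor_regular_fin ('I_k + 'I_l)%type
   (fun s => match s with inl i => a i | inr j => c j end)
   (fun s => match s with inl i => b i | inr j => d j end)).
- by case.
- by case.
- by move=> x y Ux Vy; rewrite big_sumType /= FE// GE.
Qed.

Lemma tensor_regularM F G : tensor_regular U V F -> tensor_regular U V G ->
  tensor_regular U V (fun x y => F x y * G x y).
Proof.
move=> [k [a [b [ra rb FE]]]] [l [c [d [rc rd GE]]]].
apply: (@tensor_regular_fin ('I_k * 'I_l)%type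
   (fun s x => a s.1 x * c s.2 x) (fun s y => b s.1 y * d s.2 y)).
- by move=> s; apply: (regularM sX).
- by move=> s; apply: (regularM sY).
- move=> x y Ux Vy; rewrite FE// GE// big_distrlr pair_bigA /=.
  by apply: eq_bigr => -[i j] _ /=; ring.
Qed.

Lemma tensor_regular_sub U' V' F : is_open U' -> is_open V' ->
  U `<=` U' -> V `<=` V' -> tensor_regular U' V' F -> tensor_regular U V F.
Proof.
move=> oU' oV' UU VV [k [a [b [ra rb FE]]]]; exists k, a, b; split.
- by move=> i; apply: (regular_sub sX) oU' _ _ (ra i).
- by move=> i; apply: (regular_sub sY) oV' _ _ (rb i).
- by move=> x y /UU Ux /VV Vy; apply: FE.
Qed.

End TensorRegular.

Section ProductSheaf.
Variables (X Y : space K) (sX : sheaf_of_functions X) (sY : sheaf_of_functions Y).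

(** Both functions are quotients of tensor functions on one common
    neighbourhood, where sums and products of quotients can be computed. *)
Lemma product_regular2 (W : set (X * Y)) f g x y : W (x, y) ->
  product_regular W f -> product_regular W g ->
  exists (U : set X) (V : set Y) (F F' G G' : X -> Y -> K),
    [/\ [/\ is_open U, U x, is_open V & V y],
        [/\ tensor_regular U V F, tensor_regular U V F',
            tensor_regular U V G & tensor_regular U V G'],
        G x y != 0, G' x y != 0 &
        forall x' y', U x' -> V y' -> G x' y' * G' x' y' != 0 -> W (x', y') ->
          f (x', y') = F x' y' / G x' y' /\ g (x', y') = F' x' y' / G' x' y'].
Proof.
move=> Wxy rf rg.
have [U1 [V1 [F1 [G1 [[oU1 Ux1 oV1 Vy1] tF1 tG1 G10 f1]]]]] := rf _ _ Wxy.
have [U2 [V2 [F2 [G2 [[oU2 Ux2 oV2 Vy2] tF2 tG2 G20 f2]]]]] := rg _ _ Wxy.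
have oU := openI sX oU1 oU2; have oV := openI sY oV1 oV2.
have sub1 := tensor_regular_sub sX sY oU oV oU1 oV1.
have sub2 := tensor_regular_sub sX sY oU oV oU2 oV2.
exists (U1 `&` U2), (V1 `&` V2), F1, F2, G1, G2; split=> //.
- by split; [apply: sub1|apply: sub2|apply: sub1|apply: sub2] => // ? [].
- move=> x' y' [? ?] [? ?]; rewrite mulf_eq0 negb_or => /andP[? ?] ?.
  by split; [apply: f1|apply: f2].
Qed.

Lemma product_sheaf : sheaf_of_functions (product X Y).
Proof.
have oN (W : set (X * Y)) f : product_open W -> product_regular W f ->
    product_open (W `&` [set p | f p != 0]).
  move=> oW rf x y [Wxy /= fxy].
  have [U1 [V1 [F1 [[oU1 Ux1 oV1 Vy1] tF1 F10 h1]]]] := oW _ _ Wxy.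
  have [U2 [V2 [F2 [G2 [[oU2 Ux2 oV2 Vy2] tF2 tG2 G20 h2]]]]] := rf _ _ Wxy.
  have oU := openI sX oU1 oU2; have oV := openI sY oV1 oV2.
  have sub1 := tensor_regular_sub sX sY oU oV oU1 oV1.
  have sub2 := tensor_regular_sub sX sY oU oV oU2 oV2.
  exists (U1 `&` U2), (V1 `&` V2), (fun x y => F1 x y * (F2 x y * G2 x y)).
  split=> //.
  - apply: (tensor_regularM sX sY) => //; first by apply: sub1 => // ? [].
    by apply: (tensor_regularM sX sY) => //; apply: sub2 => // ? [].
  - rewrite !mulf_neq0//; apply: contraNneq fxy => F0.
    by rewrite h2// F0 mul0r.
  - move=> x' y' [? ?] [? ?].
    rewrite !mulf_eq0 !negb_or => /andP[? /andP[? ?]].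
    have Wxy' : W (x', y') by apply: h1.
    by split=> //=; rewrite h2// mulf_neq0// invr_neq0.
have base U V (F : X -> Y -> K) : is_open U -> is_open V -> tensor_regular U V F ->
    product_open [set p | [/\ U p.1, V p.2 & F p.1 p.2 != 0]].
  by move=> oU oV tF x y [/= Ux Vy Fxy]; exists U, V, F; split.
split=> /=.
- move=> x y _; have oX := openT sX; have oY := openT sY.
  exists setT, setT, (fun _ _ => 1); split=> //; last exact: oner_neq0.
  exact: tensor_regular_cst.
- move=> W W' oW oW' x y [Wxy Wxy'].
  have [U1 [V1 [F1 [[oU1 Ux1 oV1 Vy1] tF1 F10 h1]]]] := oW _ _ Wxy.
  have [U2 [V2 [F2 [[oU2 Ux2 oV2 Vy2] tF2 F20 h2]]]] := oW' _ _ Wxy'.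
  have oU := openI sX oU1 oU2; have oV := openI sY oV1 oV2.
  exists (U1 `&` U2), (V1 `&` V2), (fun x y => F1 x y * F2 x y); split=> //.
  + apply: (tensor_regularM sX sY) => //.
      by apply: tensor_regular_sub tF1 => // ? [].
    by apply: tensor_regular_sub tF2 => // ? [].
  + by rewrite mulf_neq0.
  + move=> x' y' [? ?] [? ?]; rewrite !mulf_eq0 !negb_or => /andP[? ?].
    by split; [apply: h1|apply: h2].
- move=> W h x y /h[W' [oW' Wxy' sub]].
  have [U [V [F [bx tF F0 FW]]]] := oW' _ _ Wxy'.
  by exists U, V, F; split=> // x' y' ? ? ?; apply/sub/FW.
- move=> W W' f _ _ sub rf x y /sub Wxy.
  have [U [V [F [G [bx tF tG G0 fE]]]]] := rf _ _ Wxy.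
  by exists U, V, F, G; split=> // x' y' ? ? ? /sub; apply: fE.
- move=> W f _ h x y Wxy; have [W' [g [oW' Wxy' rg fg]]] := h _ Wxy.
  have [U1 [V1 [F1 [[oU1 Ux1 oV1 Vy1] tF1 F10 h1]]]] := oW' _ _ Wxy'.
  have [U2 [V2 [F2 [G2 [[oU2 Ux2 oV2 Vy2] tF2 tG2 G20 h2]]]]] := rg _ _ Wxy'.
  have oU := openI sX oU1 oU2; have oV := openI sY oV1 oV2.
  have tF : tensor_regular (U1 `&` U2) (V1 `&` V2) F1.
    by apply: tensor_regular_sub tF1 => // ? [].
  exists (U1 `&` U2), (V1 `&` V2), (fun x y => F1 x y * F2 x y),
    (fun x y => F1 x y * G2 x y); split=> //.
  + apply: (tensor_regularM sX sY) => //.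
    by apply: tensor_regular_sub tF2 => // ? [].
  + apply: (tensor_regularM sX sY) => //.
    by apply: tensor_regular_sub tG2 => // ? [].
  + by rewrite mulf_neq0.
  + move=> x' y' [? ?] [? ?]; rewrite !mulf_eq0 !negb_or => /andP[? ?] ?.
    have ? : W' (x', y') by apply: h1.
    by rewrite fg// h2// -mulf_div divff// mul1r.
- move=> W a _ x y _; have oX := openT sX; have oY := openT sY.
  exists setT, setT, (fun _ _ => a), (fun _ _ => 1); split=> //.
  + exact: tensor_regular_cst.
  + exact: tensor_regular_cst.
  + exact: oner_neq0.
  + by move=> *; rewrite divr1.
- move=> W f g _ rf rg x y Wxy.
  have [U [V [F [F' [G [G' [[oU Ux oV Vy] [tF tF' tG tG'] G0 G0' h]]]]]]] :=
    product_regular2 Wxy rf rg.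
  exists U, V, (fun x y => F x y * G' x y + F' x y * G x y),
    (fun x y => G x y * G' x y); split=> //.
  + by apply: tensor_regularD; apply: (tensor_regularM sX sY).
  + exact: (tensor_regularM sX sY).
  + by rewrite mulf_neq0.
  + move=> x' y' Ux' Vy' GG /h[]// -> ->.
    by move: GG; rewrite mulf_eq0 negb_or => /andP[? ?]; rewrite addf_div.
- move=> W f g _ rf rg x y Wxy.
  have [U [V [F [F' [G [G' [[oU Ux oV Vy] [tF tF' tG tG'] G0 G0' h]]]]]]] :=
    product_regular2 Wxy rf rg.
  exists U, V, (fun x y => F x y * F' x y),
    (fun x y => G x y * G' x y); split=> //.
  + exact: (tensor_regularM sX sY).
  + exact: (tensor_regularM sX sY).
  + by rewrite mulf_neq0.
  + by move=> x' y' Ux' Vy' GG /h[]// -> ->; rewrite mulf_div.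
- exact: oN.
- move=> W f oW rf x y [Wxy /= fxy].
  have [U [V [F [G [[oU Ux oV Vy] tF tG G0 fE]]]]] := rf _ _ Wxy.
  exists U, V, (fun x y => G x y * G x y), (fun x y => G x y * F x y); split=> //.
  + exact: (tensor_regularM sX sY).
  + exact: (tensor_regularM sX sY).
  + by rewrite mulf_neq0//; apply: contraNneq fxy => F0; rewrite fE// F0 mul0r.
  + move=> x' y' ? ?; rewrite mulf_eq0 negb_or => /andP[G0' ?] [? _].
    by rewrite fE// invf_div -mulf_div divff// mul1r.
Qed.

Lemma regular_fst a : regular setT a -> @regular _ (product X Y) setT (a \o fst).
Proof.
move=> ra x y _; have oX := openT sX; have oY := openT sY.
exists setT, setT, (fun x _ => a x), (fun _ _ => 1); split=> //.
- have [k [p [q [rp rq E]]]] := tensor_regular_pure ra (regular_cst sY 1 oY).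
  by exists k, p, q; split=> // x' y' _ _; rewrite -E// mulr1.
- exact: tensor_regular_cst.
- exact: oner_neq0.
- by move=> *; rewrite divr1.
Qed.

Lemma regular_snd b : regular setT b -> @regular _ (product X Y) setT (b \o snd).
Proof.
move=> rb x y _; have oX := openT sX; have oY := openT sY.
exists setT, setT, (fun _ y => b y), (fun _ _ => 1); split=> //.
- have [k [p [q [rp rq E]]]] := tensor_regular_pure (regular_cst sX 1 oX) rb.
  by exists k, p, q; split=> // x' y' _ _; rewrite -E// mul1r.
- exact: tensor_regular_cst.
- exact: oner_neq0.
- by move=> *; rewrite divr1.
Qed.

End ProductSheaf.

Lemma morphism_comp X Y Z (f : X -> Y) (g : Y -> Z) :
  morphism f -> morphism g -> morphism (g \o f).
Proof.
move=> mf mg U /mg[oU rU]; have [oV rV] := mf _ oU.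
by split=> // phi /rU/rV.
Qed.

Lemma morphism_affine X m (h : X -> affine_space K m) : sheaf_of_functions X ->
  (forall i, regular setT (fun x => h x 0 i)) -> morphism h.
Proof.
move=> sX rh U /= oU; have oX := openT sX.
have rp (p : {mpoly K[m]}) := regular_meval sX p oX rh.
have oV : is_open (h @^-1` U).
  apply: (open_neq0_locally sX) => x /= Ux.
  have [p px pU] := (affine_openP U).1 oU _ Ux.
  by exists setT, (fun x => p.@[h x 0]); split=> // y _; apply: pU.
split=> // phi /(affine_regularP _ oU) rphi.
apply: (regular_fraction sX) => // x /= Ux.
have [p [q [qx E]]] := rphi _ Ux.
exists setT, (fun x => p.@[h x 0]), (fun x => q.@[h x 0]); split=> //.
by split=> // y /= Uy _; apply: E.
Qed.

Lemma morphism_induced X Y T (i : T -> Y) (f : X -> induced i) :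
  sheaf_of_functions X -> @morphism _ X Y (i \o f) -> morphism f.
Proof.
move=> sX mf _ [U oU ->]; have [oV rV] := mf U oU; split=> // phi rphi.
apply: (regular_locally sX) => // x /= Ux.
have [U' [F [oU' Ux' rF phiF]]] := rphi _ Ux.
have [oW rW] := mf U' oU'.
exists [set y | U' (i (f y))], (fun y => F (i (f y))); split=> //; first exact: rW.
by move=> y /= Uy Uy'; apply: phiF.
Qed.

Lemma morphism_coinduced X T (pi : X -> T) : @morphism _ X (coinduced pi) pi.
Proof. by move=> U oU; split. Qed.

(** Universal property of the product: tensor functions pull back to sums of
    products of regular functions. *)
Lemma morphism_product X Y Z (f : X -> product Y Z) : sheaf_of_functions X ->
  @morphism _ X Y (fst \o f) -> @morphism _ X Z (snd \o f) -> morphism f.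
Proof.
move=> sX m1 m2.
have tens U V (F : Y -> Z -> K) : is_open U -> is_open V ->
  tensor_regular U V F ->
  is_open (((fst \o f) @^-1` U) `&` ((snd \o f) @^-1` V)) /\
  regular (((fst \o f) @^-1` U) `&` ((snd \o f) @^-1` V))
    (fun x => F (f x).1 (f x).2).
  move=> /m1[oU rU] /m2[oV rV] [k [a [b [ra rb FE]]]].
  have oUV := openI sX oU oV; split=> //.
  apply: (@eq_regular _ sX _ _ (fun x => \sum_(i < k) a i (f x).1 * b i (f x).2)) => //.
    by move=> x [/= ? ?]; rewrite FE.
  apply: (regular_sum sX) => // i _; apply: (regularM sX) => //.
    by apply: (regular_sub sX) oU _ _ (rU _ (ra i)) => // x [].
  by apply: (regular_sub sX) oV _ _ (rV _ (rb i)) => // x [].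
move=> W oW.
have oV : is_open (f @^-1` W).
  apply: (open_neq0_locally sX) => x /=; case E: (f x) => [y z] Wyz.
  have [U [V [F [[oU Uy oV Vz] tF F0 FW]]]] := oW _ _ Wyz.
  have [oUV rF] := tens _ _ _ oU oV tF.
  exists (((fst \o f) @^-1` U) `&` ((snd \o f) @^-1` V)), (fun x => F (f x).1 (f x).2).
  split=> //; rewrite /= ?E// => x' [/= ? ?] ?.
  by rewrite (surjective_pairing (f x')); apply: FW.
split=> // phi rphi; apply: (regular_fraction sX) => // x /=.
case E: (f x) => [y z] Wyz.
have [U [V [F [G [[oU Uy oV' Vz] tF tG G0 phiE]]]]] := rphi _ _ Wyz.
have [oUV rF] := tens _ _ _ oU oV' tF; have [_ rG] := tens _ _ _ oU oV' tG.
exists (((fst \o f) @^-1` U) `&` ((snd \o f) @^-1` V) `&`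
    [set x | G (f x).1 (f x).2 != 0]),
  (fun x => F (f x).1 (f x).2), (fun x => G (f x).1 (f x).2).
have oUVG := open_neq0 sX oUV rG.
split=> //.
- by rewrite /= E.
- by apply: (regular_sub sX) oUV _ _ rF => // ? [].
- by apply: (regular_sub sX) oUV _ _ rG => // ? [].
split=> [|x' /= Wx' [[/= ? ?] ?]]; first by rewrite E.
rewrite (surjective_pairing (f x')) phiE//= ?divfK//.
by rewrite -surjective_pairing.
Qed.

End Sheaves.

(** * Invariants of the cyclic group acting on the plane *)

Section Invariants.
Variables (K : closedFieldType) (n : nat) (zeta : K).
Hypothesis zeta_prim : n.-primitive_root zeta.
Local Notation act := (cyclic_act zeta).
Local Notation proj := (@orbit_proj K (affine_space K 2) act).

Let n_gt0 : (0 < n)%N := prim_order_gt0 zeta_prim.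

(** Averaging over the group divides by n, so its order must be invertible. *)
Lemma prim_root_order_neq0 : n%:R != 0 :> K.
Proof.
rewrite natf_neq0_pchar; apply/(pnatP _ n_gt0) => p p_pr pn; apply/negP => /= pK.
by have := prim_root_pcharF zeta_prim pn; rewrite pK.
Qed.

Lemma prim_root_neq0 : zeta != 0.
Proof.
apply/eqP => z0; have := prim_expr_order zeta_prim.
by rewrite z0 expr0n gtn_eqF// => /eqP; rewrite eq_sym oner_eq0.
Qed.

Lemma prim_root_inv : zeta^-1 = zeta ^+ n.-1.
Proof.
apply: (mulfI prim_root_neq0); rewrite divff ?prim_root_neq0//.
by rewrite -exprS prednK// (prim_expr_order zeta_prim).
Qed.

Lemma iter_cyclic_act k (w : 'rV[K]_2) :
  (iter k act w 0 0 = zeta ^+ k * w 0 0) *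
  (iter k act w 0 1 = zeta ^- k * w 0 1).
Proof.
elim: k => [|k [IH0 IH1]] /=; first by rewrite expr0 invr1 !mul1r.
by rewrite !mxE /= IH0 IH1 !mulrA -invfM -!exprS.
Qed.

Lemma row2P (v w : 'rV[K]_2) : v 0 0 = w 0 0 -> v 0 1 = w 0 1 -> v = w.
Proof.
move=> e0 e1; apply/rowP => i; have [->|->] // : i = 0 \/ i = 1.
by case: i => -[|[|//]] h; [left|right]; apply: val_inj.
Qed.

Lemma iter_cyclic_act_order w : iter n act w = w.
Proof.
by apply: row2P; rewrite !iter_cyclic_act (prim_expr_order zeta_prim) ?invr1 mul1r.
Qed.

Lemma orbit_proj_iter k (w : affine_space K 2) :
  proj (iter k act w) = proj w.
Proof.
suff h (x : affine_space K 2) : proj (act x) = proj x.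
  by elim: k => // k IH; rewrite iterS h.
apply: eq_exist; apply/seteqP; split=> y [j ->].
  by exists j.+1; rewrite iterSr.
exists (j + n.-1)%N; rewrite iterD -iterSr prednK//.
by rewrite iter_cyclic_act_order.
Qed.

Lemma sum_prim_root k : \sum_(i < n) zeta ^+ (k * i) = if (n %| k)%N then n%:R else 0.
Proof.
case: ifP => [/dvdnP[q ->]|nk].
  rewrite (eq_bigr (fun=> 1)) ?sumr_const ?card_ord// => i _.
  by rewrite mulnAC exprM exprAC (prim_expr_order zeta_prim) !expr1n.
have zk : zeta ^+ k != 1 by rewrite -(prim_order_dvd zeta_prim) nk.
apply: (mulfI (x := zeta ^+ k - 1)); first by rewrite subr_eq0.
rewrite mulr0 (eq_bigr (fun i : 'I_n => (zeta ^+ k) ^+ i)) => [|i _]; last by rewrite exprM.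
by rewrite -subrX1 exprAC (prim_expr_order zeta_prim) expr1n subrr.
Qed.

(** The generator multiplies a monomial by zeta to this power, as
    zeta^-1 = zeta^(n-1). *)
Definition mweight (m : 'X_{1..2}) : nat := (m 0%R + n.-1 * m 1%R)%N.

(** The isotypic component on which the generator acts by zeta^-i, cut out
    monomial by monomial. *)
Definition wcomp (i : nat) (p : {mpoly K[2]}) : {mpoly K[2]} :=
  \sum_(m <- msupp p | (n %| mweight m + i)%N) p@_m *: 'X_[m].

Lemma mevalXn m (v : 'I_m -> K) (p : {mpoly K[m]}) k : (p ^+ k).@[v] = p.@[v] ^+ k.
Proof. exact: rmorphXn. Qed.

Lemma meval_mono2 (m : 'X_{1..2}) (w : 'rV[K]_2) :
  'X_[m].@[w 0] = w 0 0 ^+ m 0 * w 0 1 ^+ m 1.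
Proof.
rewrite mevalX !big_ord_recl big_ord0 mulr1; congr (_ * _ ^+ m _).
  by congr (w 0 _); apply: val_inj.
exact: val_inj.
Qed.

Lemma meval_act k (m : 'X_{1..2}) (w : 'rV[K]_2) :
  'X_[m].@[iter k act w 0] = zeta ^+ (mweight m * k) * 'X_[m].@[w 0].
Proof.
rewrite !meval_mono2 !iter_cyclic_act !exprMn -exprM -exprVn prim_root_inv -!exprM.
rewrite mulrACA -exprD /mweight; congr (_ ^+ _ * _); move: n.-1 => N; lia.
Qed.

(** The projection onto an isotypic component is the twisted average over
    the group; this transfers pointwise identities from p to its components. *)
Lemma meval_wcomp i p (w : 'rV[K]_2) :
  n%:R * (wcomp i p).@[w 0] =
  \sum_(k < n) zeta ^+ (i * k) * p.@[iter k act w 0].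
Proof.
have E v : p.@[v] = \sum_(m <- msupp p) p@_m * 'X_[m].@[v].
  by rewrite {1}[p]mpolyE raddf_sum; apply: eq_bigr => m _; rewrite /= mevalZ.
under eq_bigr => k _ do rewrite E big_distrr /=.
rewrite exchange_big /wcomp raddf_sum big_mkcond big_distrr /=.
apply: eq_bigr => m _.
under eq_bigr => k _ do rewrite meval_act.
transitivity ((\sum_(k < n) zeta ^+ ((mweight m + i) * k)) * (p@_m * 'X_[m].@[w 0])).
  by rewrite sum_prim_root; case: ifP; rewrite ?mevalZ // mul0r mulr0.
rewrite big_distrl; apply: eq_bigr => k _ /=.
rewrite mulnDl exprD; ring.
Qed.

Lemma wcomp_act i p (w : 'rV[K]_2) :
  zeta ^+ i * (wcomp i p).@[act w 0] = (wcomp i p).@[w 0].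
Proof.
apply: (mulfI prim_root_order_neq0); rewrite mulrCA !meval_wcomp.
have zn := prim_expr_order zeta_prim.
have an := iter_cyclic_act_order w.
case: n n_gt0 zn an => // N _ zn an.
rewrite [in LHS]big_ord_recr [in RHS]big_ord_recl /= addrC mulrDr.
rewrite [X in _ + X = _]mulr_sumr.
congr (_ + _).
  rewrite mulrA -exprD -mulnS mulnC exprM zn expr1n muln0 mul1r.
  by rewrite expr0 mul1r -iterSr an.
apply: eq_bigr => k _.
by rewrite mulrA -exprD -mulnS -iterSr.
Qed.

Lemma wcomp_neq0 p (w : 'rV[K]_2) : p.@[w 0] != 0 ->
  exists i, (wcomp i p).@[w 0] != 0.
Proof.
move=> pw; apply: contrapT => h; move/eqP: pw; apply.
have {}h i : (wcomp i p).@[w 0] = 0.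
  by apply/eqP/negPn/negP => c; apply: h; exists i.
apply: (mulfI prim_root_order_neq0); rewrite mulr0.
transitivity (\sum_(i < n) \sum_(k < n) zeta ^+ (k * i) * p.@[iter k act w 0]).
  rewrite exchange_big /= (bigD1 (Ordinal n_gt0)) //= -big_distrl /=.
  rewrite sum_prim_root dvdn0 big1 ?addr0// => k k0.
  have k_gt0 : (0 < k)%N by rewrite lt0n; apply: contraNneq k0 => k0; apply/eqP/val_inj.
  by rewrite -big_distrl sum_prim_root gtnNdvd//= mul0r.
apply: big1 => i _; under eq_bigr => k _ do rewrite mulnC.
by rewrite -meval_wcomp h mulr0.
Qed.

Definition invariants (w : 'rV[K]_2) : 'rV[K]_3 :=
  \row_(i < 3) [:: w 0 0 * w 0 1; w 0 0 ^+ n; w 0 1 ^+ n]`_i.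

(** A monomial X^a Y^b with a = b mod n is a power of XY times a power of X^n
    or of Y^n, and an invariant polynomial has the same values as its component
    of weight 0, which is a sum of such monomials. *)
Lemma invariant_poly (G : {mpoly K[2]}) :
  (forall w : 'rV[K]_2, G.@[act w 0] = G.@[w 0]) ->
  exists H : {mpoly K[3]}, forall w : 'rV[K]_2, G.@[w 0] = H.@[invariants w 0].
Proof.
move=> Gi; have Gk k (w : 'rV[K]_2) : G.@[iter k act w 0] = G.@[w 0].
  by elim: k => //= k; rewrite Gi.
pose mon (m : 'X_{1..2}) : {mpoly K[3]} :=
  'X_0 ^+ minn (m 0%R) (m 1%R) * 'X_1 ^+ ((m 0%R - m 1%R) %/ n) *
  'X_(inord 2) ^+ ((m 1%R - m 0%R) %/ n).
exists (\sum_(m <- msupp G | (n %| mweight m + 0)%N) G@_m *: mon m) => w.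
apply: (mulfI prim_root_order_neq0).
transitivity (n%:R * (wcomp 0 G).@[w 0]).
  rewrite meval_wcomp; under eq_bigr => k _ do rewrite mul0n mul1r Gk.
  by rewrite sumr_const card_ord mulr_natl.
congr (_ * _); rewrite !raddf_sum; apply: eq_bigr => m; rewrite addn0 => nm /=.
rewrite !mevalZ; congr (_ * _).
rewrite meval_mono2.
rewrite !mevalM !rmorphXn /= !mevalXU !mxE inordK//=.
rewrite exprMn -!exprM.
have [d1 d2] : (n %| m 0%R - m 1%R /\ n %| m 1%R - m 0%R)%N.
  have [le|/ltnW le] := leqP (m 1%R) (m 0%R).
    have -> : (m 1%R - m 0%R = 0)%N by apply/eqP; rewrite subn_eq0.
    split=> //; move: nm; rewrite /mweight -{1}(subnK le) -addnA -mulSn prednK//.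
    by rewrite dvdn_addl// dvdn_mulr.
  have -> : (m 0%R - m 1%R = 0)%N by apply/eqP; rewrite subn_eq0.
  split=> //; move: nm; rewrite /mweight -{1}(subnK le) mulnDr addnCA -mulSn prednK//.
  rewrite dvdn_addl; last exact: dvdn_mulr.
  rewrite Gauss_dvdr//.
  by rewrite -{1}(prednK n_gt0) coprimeSn.
rewrite ![(n * _)%N]mulnC !divnK// -mulrA mulrACA -!exprD.
by congr (_ ^+ _ * _ ^+ _); lia.
Qed.

Lemma invariants_iter k w : invariants (iter k act w) = invariants w.
Proof.
have zn := prim_expr_order zeta_prim; have zk := expf_neq0 k prim_root_neq0.
apply/rowP => i; rewrite !mxE; case: i => -[|[|[|//]]] _ /=; rewrite !iter_cyclic_act.
- by rewrite mulrACA divff// mul1r.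
- by rewrite exprMn exprAC zn expr1n mul1r.
- by rewrite exprMn exprVn exprAC zn expr1n invr1 mul1r.
Qed.

(** An open set U of the quotient contains, around any of its points, the
    non-vanishing locus of a polynomial in the invariants: if r does not vanish
    at v and its non-vanishing locus lies in the preimage of U, some component
    r_i does not vanish at v; r_i^n is invariant, and wherever it is nonzero so
    is r at some point of the orbit. *)
Lemma open_invariant (U : set (cyclic_singularity zeta)) (v : 'rV[K]_2) :
  is_open U -> U (proj v) -> exists H : {mpoly K[3]},
    H.@[invariants v 0] != 0 /\
    forall w, H.@[invariants w 0] != 0 -> U (proj w).
Proof.
move=> /affine_openP oU /oU[r /wcomp_neq0[i ri] rU].
have [w|H HE] := @invariant_poly (wcomp i r ^+ n).
  rewrite !mevalXn -(wcomp_act i r w) exprMn exprAC (prim_expr_order zeta_prim).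
  by rewrite expr1n mul1r.
exists H; rewrite -HE mevalXn expf_neq0//; split=> // w.
rewrite -HE mevalXn expf_eq0 n_gt0 /= => rw.
suff [k rk] : exists k, r.@[iter k act w 0] != 0.
  by rewrite -(orbit_proj_iter k); apply: rU.
apply: contrapT => h; move/eqP: rw; apply.
apply: (mulfI prim_root_order_neq0); rewrite meval_wcomp mulr0 big1// => k _.
have -> : r.@[iter k act w 0] = 0; last by rewrite mulr0.
by apply/eqP/negPn/negP => c; apply: h; exists k.
Qed.

(** From phi q = p one gets phi q_i = p_i by averaging, then
    phi q_i^n = p_i q_i^(n-1), where both polynomials are invariant. *)
Lemma regular_invariant (U : set (cyclic_singularity zeta)) phi (v : 'rV[K]_2) :
  is_open U -> regular U phi -> U (proj v) -> exists P Q : {mpoly K[3]},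
    Q.@[invariants v 0] != 0 /\
    forall w, U (proj w) -> phi (proj w) * Q.@[invariants w 0] = P.@[invariants w 0].
Proof.
move=> oU /(affine_regularP _ oU) rphi Uv.
have [p [q [/wcomp_neq0[i qi] phiE]]] := rphi v Uv.
have phiE' w : U (proj w) ->
    phi (proj w) * (wcomp i q).@[w 0] = (wcomp i p).@[w 0].
  move=> Uw; apply: (mulfI prim_root_order_neq0); rewrite mulrCA !meval_wcomp.
  rewrite mulr_sumr; apply: eq_bigr => k _; rewrite mulrCA; congr (_ * _).
  by rewrite -phiE /= orbit_proj_iter.
have zn : (zeta ^+ i) ^+ n = 1.
  by rewrite exprAC (prim_expr_order zeta_prim) expr1n.
have [w|Q QE] := @invariant_poly (wcomp i q ^+ n).
  by rewrite !mevalXn -(wcomp_act i q w) exprMn zn mul1r.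
have [w|P PE] := @invariant_poly (wcomp i p * wcomp i q ^+ n.-1).
  rewrite !mevalM !mevalXn -(wcomp_act i q w) -(wcomp_act i p w) exprMn mulrACA.
  by rewrite -exprS prednK// zn mul1r.
exists P, Q; rewrite -QE mevalXn expf_neq0//; split=> // w Uw.
rewrite -PE -QE mevalM !mevalXn -phiE'// -mulrA -exprS prednK//.
Qed.

(** The lift r to the plane need not be regular, or even continuous: only
    its invariants have to be regular functions. *)
Lemma morphism_cyclic_singularity (X : space K) (r : X -> 'rV[K]_2) :
  sheaf_of_functions X ->
  (forall i, regular setT (fun x => invariants (r x) 0 i)) ->
  @morphism _ X (cyclic_singularity zeta) (fun x => proj (r x)).
Proof.
move=> sX rr U oU; have oX := openT sX.
have rp (p : {mpoly K[3]}) := regular_meval sX p oX rr.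
have oV : is_open ((fun x => proj (r x)) @^-1` U).
  apply: (open_neq0_locally sX) => x /= Ux.
  have [H [Hx HU]] := open_invariant oU Ux.
  by exists setT, (fun x => H.@[invariants (r x) 0]); split=> // y _; apply: HU.
split=> // phi rphi; apply: (regular_fraction sX) => // x /= Ux.
have [p [q [qx E]]] := regular_invariant oU rphi Ux.
exists setT, (fun x => p.@[invariants (r x) 0]), (fun x => q.@[invariants (r x) 0]).
by split=> //; split=> // y /= Uy _; apply: E.
Qed.

Definition orbit_invariants (O : cyclic_singularity zeta) : 'rV[K]_3 :=
  invariants (sval (cid (svalP O))).

Lemma orbit_invariants_proj w : orbit_invariants (proj w) = invariants w.
Proof.
rewrite /orbit_invariants; case: cid => v /= E.
have [k ->] : orbit_of (X := affine_space K 2) act v w by rewrite -E; exists 0%N.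
exact/esym/invariants_iter.
Qed.

Lemma regular_orbit_invariants i : regular setT (fun O => orbit_invariants O 0 i).
Proof.
have sA := affine_sheaf K 2; have oA := openT sA.
have rc (j : 'I_2) : @regular _ (affine_space K 2) setT (fun w => w 0 j).
  apply/(affine_regularP _ oA) => v _; exists 'X_j, 1.
  by rewrite meval1 oner_neq0; split=> // w _; rewrite meval1 mulr1 mevalXU.
change (@regular _ (affine_space K 2) setT (fun w => orbit_invariants (proj w) 0 i)).
apply: (eq_regular sA (g := fun w => invariants w 0 i)) => // [w _|].
  by rewrite orbit_invariants_proj.
case: i => -[|[|[|//]]] lti.
- apply: (eq_regular sA (g := fun w : 'rV[K]_2 => w 0 0 * w 0 1)) => //.
    by move=> w _; rewrite mxE.
  by apply: (regularM sA).
- apply: (eq_regular sA (g := fun w : 'rV[K]_2 => w 0 0 ^+ n)) => //.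
    by move=> w _; rewrite mxE.
  by apply: (regularX sA).
- apply: (eq_regular sA (g := fun w : 'rV[K]_2 => w 0 1 ^+ n)) => //.
    by move=> w _; rewrite mxE.
  by apply: (regularX sA).
Qed.

Let expn_order_eq0 (a : K) : (a ^+ n == 0) = (a == 0).
Proof. by rewrite expf_eq0 n_gt0. Qed.

(** Unless v is the origin, w_j / v_j is an n-th root of unity for a
    coordinate v_j that is nonzero, hence a power of zeta (or of its inverse),
    and the product of the coordinates determines the other one. *)
Lemma invariants_orbit v w : invariants v = invariants w -> proj v = proj w.
Proof.
move=> /rowP E; have := E 0; have := E 1; have := E (inord 2).
rewrite !mxE inordK//= => e2 e1 e0.
suff [k ->] : exists k, w = iter k act v by rewrite orbit_proj_iter.
have inv_prim : n.-primitive_root zeta^-1.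
  rewrite prim_root_inv (prim_root_exp_coprime _ zeta_prim) // coprime_sym.
  by rewrite -{1}(prednK n_gt0) coprimeSn.
have [v0|v0] := eqVneq (v 0 0) 0.
  have w0 : w 0 0 = 0.
    by apply/eqP; rewrite -expn_order_eq0 -e1 v0 expr0n gtn_eqF.
  have [v1|v1] := eqVneq (v 0 1) 0.
    exists 0%N; apply: row2P; rewrite ?v0 ?w0// v1; apply/eqP.
    by have := esym e2; rewrite v1 expr0n gtn_eqF// => /eqP; rewrite expn_order_eq0.
  have /(prim_rootP inv_prim)[k kE] : (w 0 1 / v 0 1) ^+ n = 1.
    by rewrite expr_div_n -e2 divff// expf_neq0.
  exists k; apply: row2P; rewrite iter_cyclic_act ?v0 ?mulr0//.
  by rewrite -exprVn -kE divfK.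
have /(prim_rootP zeta_prim)[k kE] : (w 0 0 / v 0 0) ^+ n = 1.
  by rewrite expr_div_n -e1 divff// expf_neq0.
have w0E : w 0 0 = zeta ^+ k * v 0 0 by rewrite -kE divfK.
exists k; apply: row2P; rewrite iter_cyclic_act//.
have zk := expf_neq0 k prim_root_neq0.
apply: (mulfI zk); rewrite mulVKf//; apply: (mulfI v0).
by rewrite e0 w0E; ring.
Qed.

Lemma exists_root k (a : K) : (0 < k)%N -> exists b, b ^+ k = a.
Proof.
move=> k0; have /closed_rootP[b] : size ('X^k - a%:P) != 1%N.
  by rewrite size_XnsubC// -(prednK k0).
by rewrite rootE !hornerE subr_eq0 => /eqP; exists b.
Qed.

(** Take p an n-th root of c and q = x / p; if c = 0 then x = 0 and p = 0,
    q an n-th root of t will do. *)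
Lemma invariants_surj (x c t : K) : x ^+ n = c * t -> exists w,
  [/\ invariants w 0 0 = x, invariants w 0 1 = c & invariants w 0 (inord 2) = t].
Proof.
move=> xct; have mk p q : p * q = x -> p ^+ n = c -> q ^+ n = t -> exists w,
  [/\ invariants w 0 0 = x, invariants w 0 1 = c & invariants w 0 (inord 2) = t].
  by move=> *; exists (\row_(i < 2) if i == 0 then p else q); rewrite !mxE inordK.
have [c0|c0] := eqVneq c 0.
  have [q qt] := exists_root t n_gt0; apply: (mk 0 q) => //.
    by apply/esym/eqP; rewrite mul0r -expn_order_eq0 xct c0 mul0r.
  by rewrite c0 expr0n gtn_eqF.
have [p pc] := exists_root c n_gt0.
have p0 : p != 0 by apply: contraNneq c0 => p0; rewrite -pc p0 expr0n gtn_eqF.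
apply: (mk p (x / p)) => //; first by rewrite mulrC divfK.
by rewrite expr_div_n pc xct mulrC mulKf.
Qed.

End Invariants.

(** * Regular functions on the flag variety given by minors *)

Section FlagCharts.
Variables (K : closedFieldType) (n : nat).
Implicit Types (g : GL K n) (A : 'M[K]_n).

Definition upper_triangular A := forall i j : 'I_n, (j < i)%N -> A i j = 0.

Lemma mem_col_flag g (j : 'I_n) (v : 'cV[K]_n) :
  v \in val (col_flag g) j <->
  exists2 y : 'cV[K]_n, v = val g *m y & forall i : 'I_n, (j < i)%N -> y i 0 = 0.
Proof.
case: g => g ug; rewrite /col_flag /= ffunE; split=> [vj|[y -> y0]].
  exists (invmx g *m v); first by rewrite mulKVmx.
  move=> i ji; pose L := linfun (mulmx (row i (invmx g)) : 'cV[K]_n -> 'cV[K]_1).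
  have /subvP/(_ _ vj) : (<<[seq col i g | i : 'I_n <- enum 'I_n & (i <= j)%N]>> <= lker L)%VS.
    apply/span_subvP => u /mapP[k]; rewrite mem_filter => /andP[kj _] ->.
    rewrite memv_ker lfunE /= colE mulmxA -row_mul mulVmx// -colE.
    apply/eqP/matrixP => a b; rewrite !mxE; case: eqP => // ik.
    by move: ji; rewrite ik ltnNge kj.
  rewrite memv_ker lfunE /= -row_mul => /eqP/matrixP/(_ 0 0).
  by rewrite !mxE.
have -> : g *m y = \sum_i y i 0 *: col i g.
  apply/colP => a; rewrite !mxE summxE; apply: eq_bigr => i _.
  by rewrite !mxE mulrC.
apply: memv_suml => i _; have [ij|ji] := leqP i j; last first.
  by rewrite y0// scale0r mem0v.
by apply/memvZ/memv_span/map_f; rewrite mem_filter ij mem_enum.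
Qed.

Lemma dim_flag (V : flag K n) i : \dim (val V i) = i.+1.
Proof. by case: V => V /= /andP[/forallP/(_ i)/eqP]. Qed.

(** This identifies the flags with the cosets g B. *)
Lemma col_flag_eqP g g' : col_flag g = col_flag g' <->
  exists2 b : 'M[K]_n, upper_triangular b & val g' = val g *m b.
Proof.
split=> [gg|[b ub gb]].
  exists (invmx (val g) *m val g'); last by rewrite mulKVmx ?(valP g).
  move=> i j ji; have : col j (val g') \in val (col_flag g') j.
    apply/mem_col_flag; exists (delta_mx j 0); first by rewrite colE.
    by move=> k jk; rewrite !mxE; case: eqP jk => // ->; rewrite ltnn.
  rewrite -gg => /mem_col_flag[y yE y0].
  have -> : (invmx (val g) *m val g') i j = (invmx (val g) *m col j (val g')) i 0.
    by rewrite [in RHS]colE mulmxA -colE !mxE.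
  by rewrite yE mulKmx ?(valP g)// y0.
apply: val_inj; apply/ffunP => j; apply/esym/eqP.
rewrite eqEdim !dim_flag leqnn andbT; apply/subvP => v /mem_col_flag[y -> y0].
apply/mem_col_flag; exists (b *m y); first by rewrite gb mulmxA.
move=> i ji; rewrite mxE big1// => k _.
by have [/y0 ->|kj] := ltnP j k; rewrite ?mulr0// ub ?mul0r// (leq_ltn_trans kj).
Qed.

(** The rows 0, ..., j-1, i.  Together with the columns 0, ..., j they cut out
    the minors below: Cramer's rule expresses the entry (i, j) of the factor u
    in g = u b (u unitriangular, b upper triangular) as the quotient of the
    (i, j) minor of g by the (j, j) minor. *)
Definition minor_rows (i j : 'I_n) (k : 'I_j.+1) : 'I_n :=
  if k == j :> nat then i else widen_ord (ltn_ord j) k.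

Definition minor (i j : 'I_n) A : K :=
  \det (mxsub (@minor_rows i j) (widen_ord (ltn_ord j)) A).

(** The first j+1 columns of b vanish below row j, so the submatrix of A b is
    the submatrix of A times the leading block of b, whose determinant does not
    depend on i. *)
Lemma minorM i j A b : upper_triangular b ->
  minor i j (A *m b) = minor i j A * minor j j b.
Proof.
move=> ub; rewrite /minor -det_mulmx; congr (\det _); apply/matrixP => k l.
rewrite !mxE (bigID (fun a : 'I_n => (a < j.+1)%N)) /= [X in _ + X]big1 ?addr0; last first.
  by move=> a; rewrite -leqNgt => ja; rewrite ub ?mulr0//= (leq_trans (ltn_ord l)).
rewrite (big_ord_narrow (ltn_ord j)); apply: eq_bigr => a _; rewrite !mxE.
congr (_ * b _ _); rewrite /minor_rows; case: eqP => // aj.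
by apply: val_inj.
Qed.

(** The submatrix is triangular with diagonal 1, ..., 1, A i j. *)
Lemma minor_unitriangular (i j : 'I_n) A :
  is_trig_mx A -> (forall k, A k k = 1) -> minor i j A = A i j.
Proof.
move=> /is_trig_mxP tA A1; rewrite /minor det_trig; last first.
  apply/is_trig_mxP => k l kl; rewrite mxE tA// /minor_rows ifN//=.
  by rewrite ltn_eqF// (leq_trans kl)// -ltnS.
rewrite big_ord_recr big1 /= => [|k _].
  by rewrite mxE /minor_rows /= eqxx mul1r; congr (A _ _); apply: val_inj.
by rewrite mxE /minor_rows ifN ?A1//= ltn_eqF.
Qed.

(** The quotient of minors does not depend on the matrix representing V when
    the (j, j) minor is nonzero; it is picked out here as a value rather than
    through a chosen representative. *)
Definition chart_value (i j : 'I_n) (V : flag K n) : K :=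
  xget 0 [set a | exists g, V = col_flag g /\ a = minor i j (val g) / minor j j (val g)].

Definition chart_domain (j : 'I_n) : set (flag_variety K n) :=
  [set V : flag K n | exists g, V = col_flag g /\ minor j j (val g) != 0].

Lemma chart_domain_col_flag j g :
  chart_domain j (col_flag g) -> minor j j (val g) != 0.
Proof.
move=> [g' [gg m0]]; have [b ub gb] := (col_flag_eqP g g').1 gg.
by apply: contraNneq m0 => m0; rewrite gb minorM// m0 mul0r.
Qed.

Lemma chart_value_col_flag i j g : minor j j (val g) != 0 ->
  chart_value i j (col_flag g) = minor i j (val g) / minor j j (val g).
Proof.
move=> m0; rewrite /chart_value.
case: xgetP => [_ -> [g' [gg ->]]|/(_ (minor i j (val g) / minor j j (val g)))];
  last first.
  by case; exists g.
have m0' : minor j j (val g') != 0.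
  by apply: chart_domain_col_flag; exists g.
apply/eqP; rewrite eqr_div//; apply/eqP.
have [b ub ->] := (col_flag_eqP g g').1 gg.
by rewrite !minorM//; ring.
Qed.

Lemma GL_sheaf : sheaf_of_functions (GL_space K n).
Proof. exact/induced_sheaf/affine_sheaf. Qed.

Lemma flag_sheaf : sheaf_of_functions (flag_variety K n).
Proof. exact/coinduced_sheaf/GL_sheaf. Qed.

Lemma regular_entry (i j : 'I_n) :
  @regular _ (GL_space K n) setT (fun g => val g i j).
Proof.
move=> g _; have oT := openT (affine_sheaf K (n * n)).
exists setT, (fun v : 'rV[K]_(n * n) => v 0 (mxvec_index i j)); split=> //.
  apply/(affine_regularP _ oT) => v _; exists 'X_(mxvec_index i j), 1.
  by rewrite meval1 oner_neq0; split=> // w _; rewrite meval1 mulr1 mevalXU.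
by move=> h _ _; rewrite mxvecE.
Qed.

Lemma regular_minor (i j : 'I_n) :
  @regular _ (GL_space K n) setT (fun g => minor i j (val g)).
Proof.
apply: (regular_det GL_sheaf); first exact: (openT GL_sheaf).
move=> k l; apply: (eq_regular GL_sheaf
  (g := fun g => val g (minor_rows i k) (widen_ord (ltn_ord j) l))).
- exact: (openT GL_sheaf).
- by move=> g _; rewrite mxE.
- exact: regular_entry.
Qed.

Lemma chart_domain_preimage j :
  @col_flag K n @^-1` chart_domain j = setT `&` [set g | minor j j (val g) != 0].
Proof.
apply/seteqP; split=> g /=; first by move=> /chart_domain_col_flag.
by move=> [_ m0]; exists g.
Qed.

Lemma open_chart_domain j : is_open (chart_domain j).
Proof.
change (@is_open _ (GL_space K n) (@col_flag K n @^-1` chart_domain j)).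
rewrite chart_domain_preimage; apply: (open_neq0 GL_sheaf).
  exact: (openT GL_sheaf).
exact: regular_minor.
Qed.

Lemma regular_chart_value i j : regular (chart_domain j) (chart_value i j).
Proof.
change (@regular _ (GL_space K n) (@col_flag K n @^-1` chart_domain j)
  (chart_value i j \o @col_flag K n)).
rewrite chart_domain_preimage; have oT := openT GL_sheaf.
have oU := open_neq0 GL_sheaf oT (regular_minor j j).
apply: (eq_regular GL_sheaf (g := fun g => minor i j (val g) * (minor j j (val g))^-1)).
- exact: oU.
- by move=> g [_ m0] /=; rewrite chart_value_col_flag.
- apply: (regularM GL_sheaf) => //.
    by apply: (regular_sub GL_sheaf) oT _ _ (regular_minor i j).
  exact: (regularV GL_sheaf oT (regular_minor j j)).
Qed.

Definition unitriangular A := is_trig_mx A /\ forall k, A k k = 1.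

Lemma unitriangular_unitmx A : unitriangular A -> A \in unitmx.
Proof.
by move=> [tA A1]; rewrite unitmxE det_trig// big1 ?unitr1// => k _; rewrite A1.
Qed.

Definition unitriangular_GL A (uA : unitriangular A) : GL K n :=
  exist _ A (unitriangular_unitmx uA).

(** Dividing each column by its diagonal entry makes a lower triangular
    matrix unitriangular without changing its flag. *)
Lemma opposite_cellP (V : flag K n) : opposite_cell K n V <->
  exists A (uA : unitriangular A), V = col_flag (unitriangular_GL uA).
Proof.
split=> [[b tb ->]|[A [uA ->]]]; last by exists (unitriangular_GL uA) => //; case: uA.
have tb' := is_trig_mxP tb.
have d0 k : val b k k != 0.
  have := valP b; rewrite unitmxE det_trig// unitfE.
  by rewrite (bigD1 k) //= mulf_eq0 negb_or => /andP[].
pose A := val b *m diag_mx (\row_k (val b k k)^-1).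
have AE i j : A i j = val b i j / val b j j.
  by rewrite /A mul_mx_diag !mxE.
have uA : unitriangular A.
  split=> [|k]; last by rewrite AE divff.
  by apply/is_trig_mxP => i j ij; rewrite AE tb'// mul0r.
exists A, uA; apply/col_flag_eqP.
exists (diag_mx (\row_k (val b k k)^-1)) => // i j ji.
by rewrite !mxE -val_eqE gtn_eqF.
Qed.

Lemma chart_domain_unitriangular A (uA : unitriangular A) j :
  chart_domain j (col_flag (unitriangular_GL uA)).
Proof.
exists (unitriangular_GL uA); split=> //; case: (uA) => tA A1.
by rewrite minor_unitriangular//= A1 oner_neq0.
Qed.

Lemma chart_value_unitriangular A (uA : unitriangular A) i j :
  chart_value i j (col_flag (unitriangular_GL uA)) = A i j.
Proof.
case: (uA) => tA A1.
by rewrite chart_value_col_flag !minor_unitriangular//= A1 ?oner_neq0// divr1.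
Qed.

Lemma regular_cell_chart (S : set (flag_variety K n)) i j :
  S `<=` opposite_cell K n ->
  @regular _ (subspace S) setT (fun V => chart_value i j (sval V)).
Proof.
move=> SO V _; exists (chart_domain j), (chart_value i j); split=> //.
- exact: open_chart_domain.
- by case: V => V /= /SO/opposite_cellP[A [uA ->]]; apply: chart_domain_unitriangular.
- exact: regular_chart_value.
Qed.

End FlagCharts.

(** * The Hessenberg variety in coordinates on the opposite cell *)

Section Horner.
Variables (K : comNzRingType).
Implicit Types (x : K) (B : nat -> K).

(** The sum of the x^(k-1-l) B_l for l < k, in Horner form, so that it satisfies
    the recurrence of the first column by definition. *)
Fixpoint horner_sum x B k := if k is k'.+1 then x * horner_sum x B k' + B k' else 0.

Lemma eq_horner_sum x B B' k : (forall l, (l < k)%N -> B l = B' l) ->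
  horner_sum x B k = horner_sum x B' k.
Proof.
elim: k => //= k IH h; rewrite IH ?h// => l lk.
by apply: h; apply: ltnW.
Qed.

Lemma solve_recurrence x c (a B : nat -> K) n : a 0%N = 1 ->
  ((forall k, (k < n)%N -> a k.+1 = x * a k + c * B k) <->
   (forall k, (k <= n)%N -> a k = x ^+ k + c * horner_sum x B k)).
Proof.
move=> a0; split=> h k; last first.
  by move=> kn; rewrite !h//= 1?ltnW// exprS; ring.
elim: k => [_|k IH kn]; first by rewrite a0 mulr0 addr0.
by rewrite h// IH ?(ltnW kn)//= exprS; ring.
Qed.

End Horner.

Section NormalForm.
Variables (K : closedFieldType) (N : nat).
Local Notation n := N.+3.
Implicit Types (A : 'M[K]_n).

(** Columns as sequences: the value 0 beyond the last row encodes the zero in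
    the last row of N a. *)
Definition entry A (j : 'I_n) (k : nat) : K :=
  if (k < n)%N then A (inord k) j else 0.

Lemma entryE A (i j : 'I_n) : entry A j i = A i j.
Proof. by rewrite /entry ltn_ord inord_val. Qed.

(** The three coordinates of the surface x^n = c t. *)
Definition cell_x A := entry A 0 1.
Definition cell_c A := entry A 0 2 - entry A 0 1 ^+ 2.
Definition cell_t A := - horner_sum (cell_x A) (entry A 1) n.

Lemma jordan_block_col A j (i : 'I_n) :
  (jordan_block K n *m col j A) i 0 = entry A j i.+1.
Proof.
rewrite mxE /entry; case: ifPn => [lt|].
  rewrite (bigD1 (inord i.+1)) //= big1 ?addr0 => [|k ki].
    by rewrite !mxE inordK// eqxx mul1r.
  rewrite !mxE; case: eqP => [ke|_]; last by rewrite mul0r.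
  by move: ki; rewrite -val_eqE /= inordK// ke eqxx.
rewrite -leqNgt => le; apply: big1 => k _; rewrite !mxE.
by rewrite ltn_eqF ?mul0r// (leq_trans (ltn_ord k)).
Qed.

Lemma h2_0 : @h2 n 0 = 1.
Proof. by apply: val_inj; rewrite /= h2E. Qed.

(** N a = y_0 a + y_1 b: the rows 0 and 1, where b is 0 and 1, give y_0 = x
    and y_1 = c, and the other rows are the recurrence. *)
Lemma Hess_recurrence A (uA : unitriangular A) :
  Hess (jordan_block K n) (@h2 n) (col_flag (unitriangular_GL uA)) <->
  forall k, (k < n)%N ->
    entry A 0 k.+1 = cell_x A * entry A 0 k + cell_c A * entry A 1 k.
Proof.
have [/is_trig_mxP tA A1] := uA.
have span2 (y : 'cV[K]_n) (k : 'I_n) : (forall i : 'I_n, (1 < i)%N -> y i 0 = 0) ->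
    (A *m y) k 0 = A k 0 * y 0 0 + A k 1 * y 1 0.
  move=> y0; rewrite mxE 2!big_ord_recl big1 /= ?addr0 => [|i _].
    by have -> : lift ord0 ord0 = 1 :> 'I_n by apply: val_inj.
  by rewrite y0 ?mulr0.
have e00 : entry A 0 0 = 1 by rewrite (entryE A 0) A1.
have e10 : entry A 1 0 = 0 by rewrite (entryE A 0) tA.
have e11 : entry A 1 1 = 1 by rewrite (entryE A 1) A1.
split=> [/(_ 0)/subvP h k kn|h i].
  have c0 : col 0 A \in val (col_flag (unitriangular_GL uA)) 0.
    apply/mem_col_flag; exists (delta_mx 0 0); first by rewrite colE.
    by move=> i i0; rewrite !mxE; case: eqP i0 => // ->.
  have := h _ (memv_img (linfun (mulmx (jordan_block K n))) c0).
  rewrite lfunE h2_0 => /mem_col_flag[y /= yE y0].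
  have {}yE l : (l < n)%N -> entry A 0 l.+1 = entry A 0 l * y 0 0 + entry A 1 l * y 1 0.
    move=> ln; have := congr1 (fun v : 'cV_n => v (Ordinal ln) 0) yE.
    by rewrite jordan_block_col span2// -!entryE.
  have y0E : y 0 0 = cell_x A by rewrite /cell_x yE// e00 e10; ring.
  have y1E : y 1 0 = cell_c A.
    by rewrite /cell_c (yE 1)// e11 y0E /cell_x; ring.
  by rewrite yE// y0E y1E; ring.
have [->|i0] := eqVneq i 0; last first.
  apply/subvP => v _; apply/mem_col_flag.
  exists (invmx A *m v) => [|j]; first by rewrite /= mulKVmx// unitriangular_unitmx.
  by rewrite h2E// ifN//= ltnNge -ltnS ltn_ord.
apply/subvP => v /memv_imgP[z /mem_col_flag[y /= -> y0] ->]; rewrite lfunE /= h2_0.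
have -> : A *m y = y 0 0 *: col 0 A.
  apply/colP => k; rewrite span2 => [|l l1]; last by rewrite y0// ltnW.
  by rewrite (y0 1)// mulr0 addr0 !mxE mulrC.
rewrite -scalemxAr; apply/memvZ/(mem_col_flag (unitriangular_GL uA)).
exists (\col_k (if k == 0 then cell_x A else if k == 1 then cell_c A else 0)).
  apply/colP => k; rewrite jordan_block_col span2 => [|l l1].
    by rewrite !mxE /= h// -!entryE [cell_x A * _]mulrC [cell_c A * _]mulrC.
  by rewrite mxE -!val_eqE /= !gtn_eqF// ltnW.
by move=> l l1; rewrite mxE -!val_eqE /= !gtn_eqF// ltnW.
Qed.

Lemma Hess_unitriangular A (uA : unitriangular A) :
  Hess (jordan_block K n) (@h2 n) (col_flag (unitriangular_GL uA)) <->
  (forall i : 'I_n, A i 0 = cell_x A ^+ i + cell_c A * horner_sum (cell_x A) (entry A 1) i)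
  /\ cell_x A ^+ n = cell_c A * cell_t A.
Proof.
have e00 : entry A 0 0 = 1 by rewrite (entryE A 0); case: uA.
rewrite Hess_recurrence (solve_recurrence _ _ _ _ e00); split=> [h|[h hn] k].
  split=> [i|]; first by rewrite -entryE h// ltnW.
  have := h n (leqnn _); rewrite {1}/entry ltnn /cell_t => /esym/eqP.
  by rewrite addr_eq0 mulrN => /eqP.
rewrite leq_eqVlt => /orP[/eqP ->|kn]; last first.
  by have := h (inord k); rewrite inordK// => <-; rewrite /entry kn.
by rewrite {1}/entry ltnn hn /cell_t mulrN addNr.
Qed.

(** The entries below the diagonal outside the first column, except the last
    entry of the second column, which is traded for t. *)
Definition free_positions : {set 'I_n * 'I_n} :=
  [set p : 'I_n * 'I_n | (0 < p.2 < p.1)%N && (p != (ord_max, 1))]%SET.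

(** For i > 0, row i contains i - 1 entries below the diagonal outside column 0; these
    numbers sum to the binomial coefficient of n - 1 over 2. *)
Lemma card_free_positions : #|free_positions| = ((n - 1) * (n - 2) %/ 2 - 1)%N.
Proof.
pose S := [set p : 'I_n * 'I_n | (0 < p.2 < p.1)%N]%SET.
have -> : free_positions = (S :\ (ord_max, 1))%SET.
  by apply/setP => p; rewrite !inE andbC.
suff <- : #|S| = ((n - 1) * (n - 2) %/ 2)%N.
  by rewrite [in RHS](cardsD1 (ord_max, 1)) inE /= addKn.
have -> : ((n - 1) * (n - 2) %/ 2 = 'C(N.+2, 2))%N by rewrite bin2 divn2 !subSS !subn0.
rewrite -bin2_sum -sum1_card.
rewrite (eq_bigl (fun p : 'I_n * 'I_n => true && (0 < p.2 < p.1)%N)); last first.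
  by move=> p; rewrite inE.
rewrite -(pair_big_dep xpredT (fun i j : 'I_n => (0 < j < i)%N) (fun _ _ => 1%N)) /=.
rewrite big_ord_recl big1 ?add0n => [|j /andP[]//].
rewrite big_mkord; apply: eq_bigr => i _; rewrite sum1_card.
rewrite -(card_ord i) -(card_imset
  (f := fun j : 'I_i => lift 0 (widen_ord (ltnW (ltn_ord i)) j) : 'I_n)).
  apply: eq_card => j.
  apply/idP/imsetP => [|[k _ ->]]; last by rewrite unfold_in /= /bump /= ltnS.
  rewrite unfold_in => /andP[j0 /= ji].
  have lt : (j.-1 < i)%N by move: ji; rewrite /bump /= -{1}(prednK j0).
  by exists (Ordinal lt) => //; apply: val_inj; rewrite /= /bump /= add1n prednK.
move=> j k /lift_inj /(congr1 val) /= jk; exact: val_inj.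
Qed.

Section Parametrization.
Variables (m : nat) (m_card : m = #|free_positions|).

Definition free_position (k : 'I_m) : 'I_n * 'I_n :=
  enum_val (cast_ord m_card k).

Lemma free_position_inj : injective free_position.
Proof. by move=> k l /enum_val_inj/cast_ord_inj. Qed.

Lemma free_positionP p :
  reflect (exists k, p = free_position k) (p \in free_positions).
Proof.
apply: (iffP idP) => [pf|[k ->]]; last exact: enum_valP.
exists (cast_ord (esym m_card) (enum_rank_in pf p)).
by rewrite /free_position cast_ordKV enum_rankK_in.
Qed.

(** Written as an affine expression in w so that its entries are visibly
    regular functions of w. *)
Definition free_matrix (w : 'rV[K]_m) : 'M[K]_n :=
  1%:M + \sum_k w 0 k *: delta_mx (free_position k).1 (free_position k).2.

Lemma free_matrixE w i j : free_matrix w i j =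
  (i == j)%:R + \sum_k w 0 k * ((i, j) == free_position k)%:R.
Proof.
rewrite /free_matrix !mxE summxE; congr (_ + _).
by apply: eq_bigr => k _; rewrite !mxE -xpair_eqE -surjective_pairing.
Qed.

Lemma free_matrix_free w k :
  free_matrix w (free_position k).1 (free_position k).2 = w 0 k.
Proof.
have : free_position k \in free_positions by apply/free_positionP; exists k.
rewrite free_matrixE -surjective_pairing !inE => /andP[/andP[_ lt] _].
rewrite -val_eqE gtn_eqF// add0r (bigD1 k)//= eqxx mulr1 big1 ?addr0// => l lk.
by rewrite (inj_eq free_position_inj) eq_sym (negPf lk) mulr0.
Qed.

Lemma free_matrix_fixed w i j : (i, j) \notin free_positions ->
  free_matrix w i j = (i == j)%:R.
Proof.
move=> nf; rewrite free_matrixE big1 ?addr0// => k _; case: eqP => [e|_].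
  by case/negP: nf; apply/free_positionP; exists k.
by rewrite mulr0.
Qed.

(** The inverse of the coordinates: the first column solves the recurrence,
    and the last entry of the second column is solved from the equation
    t = - (x s_(n-1) + b_(n-1)). *)
Definition cell_matrix (x c t : K) (w : 'rV[K]_m) : 'M[K]_n :=
  let b := entry (free_matrix w) 1 in
  \matrix_(i, j)
    if j == 0 then x ^+ i + c * horner_sum x b i
    else if (i == ord_max) && (j == 1) then - t - x * horner_sum x b N.+2
    else free_matrix w i j.

Lemma entry_cell_matrix x c t w k : (k < N.+2)%N ->
  entry (cell_matrix x c t w) 1 k = entry (free_matrix w) 1 k.
Proof.
move=> kn; rewrite /entry; case: ifP => // kn'; rewrite mxE /= ifN//.
by rewrite negb_and -val_eqE /= inordK// ltn_eqF.
Qed.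

Lemma cell_matrix_unitriangular x c t w : unitriangular (cell_matrix x c t w).
Proof.
split=> [|k].
  apply/is_trig_mxP => i j ij; rewrite mxE ifN; last first.
    by apply: contraTneq ij => ->.
  rewrite ifN; last by apply/andP => -[/eqP ei /eqP ej]; move: ij; rewrite ei ej.
  rewrite free_matrix_fixed.
    by rewrite -val_eqE ltn_eqF.
  by rewrite inE /= [(j < i)%N]ltnNge (ltnW ij) andbF.
rewrite mxE; have [->|k0] := eqVneq k 0; first by rewrite expr0 mulr0 addr0.
rewrite ifN; last by apply/andP => -[/eqP -> /eqP].
by rewrite free_matrix_fixed ?eqxx// inE /= ltnn andbF.
Qed.

Lemma cell_coords_cell_matrix x c t w :
  [/\ cell_x (cell_matrix x c t w) = x,
      cell_c (cell_matrix x c t w) = c &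
      cell_t (cell_matrix x c t w) = t].
Proof.
have b0 : entry (free_matrix w) 1 0 = 0.
  by rewrite (entryE _ 0) free_matrix_fixed// inE.
have b1 : entry (free_matrix w) 1 1 = 1.
  by rewrite (entryE _ 1) free_matrix_fixed// inE.
have xE : cell_x (cell_matrix x c t w) = x.
  by rewrite /cell_x /entry mxE /= inordK//= b0; ring.
split=> //.
  rewrite /cell_c -/(cell_x _) xE /entry mxE /= inordK//= -/(entry _ _ _).
  by rewrite b0 b1; ring.
rewrite /cell_t xE.
have -> : horner_sum x (entry (cell_matrix x c t w) 1) n =
    x * horner_sum x (entry (cell_matrix x c t w) 1) N.+2 +
    entry (cell_matrix x c t w) 1 N.+2 by [].
rewrite (@eq_horner_sum _ x _ (entry (free_matrix w) 1)); last first.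
  by move=> l; apply: entry_cell_matrix.
rewrite (entryE _ ord_max) mxE /= eqxx /=; ring.
Qed.

Lemma cell_matrix_free x c t w k :
  cell_matrix x c t w (free_position k).1 (free_position k).2 = w 0 k.
Proof.
have : free_position k \in free_positions by apply/free_positionP; exists k.
rewrite -[RHS]free_matrix_free !inE => /andP[/andP[j0 _] ne].
rewrite mxE ifN; last by rewrite -val_eqE -lt0n.
by rewrite ifN// -xpair_eqE -surjective_pairing.
Qed.

Lemma cell_matrix_Hess x c t w : x ^+ n = c * t ->
  Hess (jordan_block K n) (@h2 n)
    (col_flag (unitriangular_GL (cell_matrix_unitriangular x c t w))).
Proof.
move=> xct; apply/Hess_unitriangular.
have [-> -> ->] := cell_coords_cell_matrix x c t w; split=> // i.
rewrite mxE /=; congr (_ + _ * _); apply: eq_horner_sum => l li.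
by rewrite entry_cell_matrix// (leq_trans li)// -ltnS.
Qed.

Definition cell_free A : 'rV[K]_m :=
  \row_k A (free_position k).1 (free_position k).2.

(** The coordinates x, c, t and the free entries determine the matrix of a
    flag in the Hessenberg variety. *)
Lemma cell_matrix_coords A (uA : unitriangular A) :
  Hess (jordan_block K n) (@h2 n) (col_flag (unitriangular_GL uA)) ->
  cell_matrix (cell_x A) (cell_c A) (cell_t A) (cell_free A) = A.
Proof.
have [/is_trig_mxP tA A1] := uA; move=> /Hess_unitriangular[col0 _].
have freeE (i j : 'I_n) : j != 0 -> (i, j) != (ord_max, 1) ->
    free_matrix (cell_free A) i j = A i j.
  move=> j0 ij; have [/free_positionP[k ijk]|nf] := boolP ((i, j) \in free_positions).
    have -> : i = (free_position k).1 by rewrite -ijk.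
    have -> : j = (free_position k).2 by rewrite -ijk.
    by rewrite free_matrix_free mxE.
  rewrite free_matrix_fixed//; move: nf; rewrite inE ij andbT /= lt0n j0 /= -leqNgt.
  rewrite leq_eqVlt => /orP[/eqP/val_inj ->|lt]; first by rewrite eqxx A1.
  by rewrite tA// -val_eqE ltn_eqF.
have bE k : (k < N.+2)%N -> entry (free_matrix (cell_free A)) 1 k = entry A 1 k.
  move=> kn; rewrite /entry ltnS (ltnW kn) freeE// xpair_eqE negb_and.
  by rewrite -val_eqE /= inordK ?ltn_eqF// ltnS ltnW.
apply/matrixP => i j; rewrite mxE; have [->|j0] := eqVneq j 0.
  rewrite [RHS]col0; congr (_ + _ * _); apply: eq_horner_sum => l li.
  by rewrite bE// (leq_trans li)// -ltnS.
case: ifP => [/andP[/eqP -> /eqP ->]|/negbT nij]; last by rewrite freeE.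
rewrite (eq_horner_sum _ bE) /cell_t /= -[RHS]entryE /=; ring.
Qed.

End Parametrization.

End NormalForm.

(** * The isomorphism *)

Section Assembly.
Variables (K : closedFieldType) (N : nat).
Local Notation n := N.+3.

Section RegularCoordinates.
Variables (X : space K) (sX : sheaf_of_functions X).
Let oX := openT sX.

Lemma regular_horner_sum x (B : X -> nat -> K) k : regular setT x ->
  (forall l, regular setT (fun v => B v l)) ->
  regular setT (fun v => horner_sum (x v) (B v) k).
Proof.
move=> rx rB; elim: k => [|k IH]; first exact: (regular_cst sX).
by apply: (regularD sX) => //; apply: (regularM sX).
Qed.

Lemma regular_matrix_entry (A : X -> 'M[K]_n) j k :
  (forall i j, regular setT (fun v => A v i j)) ->
  regular setT (fun v => entry (A v) j k).
Proof.
by move=> rA; rewrite /entry; case: (k < n)%N => //; apply: (regular_cst sX).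
Qed.

Lemma regular_cell_coords (A : X -> 'M[K]_n) :
  (forall i j, regular setT (fun v => A v i j)) ->
  [/\ regular setT (fun v => cell_x (A v)),
      regular setT (fun v => cell_c (A v)) &
      regular setT (fun v => cell_t (A v))].
Proof.
move=> rA; have rE j k := regular_matrix_entry j k rA; split.
- exact: rE.
- by apply: (regularB sX) => //; apply: (regularX sX).
- apply: (regularN sX) => //; apply: regular_horner_sum => [|l]; exact: rE.
Qed.

Lemma regular_cell_matrix m (m_card : m = #|free_positions N|)
    (x c t : X -> K) (w : X -> 'rV[K]_m) i j :
  regular setT x -> regular setT c -> regular setT t ->
  (forall k, regular setT (fun v => w v 0 k)) ->
  regular setT (fun v => cell_matrix m_card (x v) (c v) (t v) (w v) i j).
Proof.
move=> rx rc rt rw.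
have rF i' j' : regular setT (fun v => free_matrix m_card (w v) i' j').
  apply: (eq_regular sX (g := fun v => (i' == j')%:R +
    \sum_k w v 0 k * ((i', j') == free_position m_card k)%:R)) => //.
    by move=> v _; rewrite free_matrixE.
  apply: (regularD sX) => //; first exact: (regular_cst sX).
  apply: (regular_sum sX) => // k _; apply: (regularM sX) => //.
  exact: (regular_cst sX).
have rS k : regular setT (fun v => horner_sum (x v) (entry (free_matrix m_card (w v)) 1) k).
  by apply: regular_horner_sum => // l; apply: regular_matrix_entry.
pose e := fun v => if j == 0 then
    x v ^+ i + c v * horner_sum (x v) (entry (free_matrix m_card (w v)) 1) i
  else if (i == ord_max) && (j == 1)
  then - t v - x v * horner_sum (x v) (entry (free_matrix m_card (w v)) 1) N.+2
  else free_matrix m_card (w v) i j.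
apply: (eq_regular sX (g := e)) => // [v _|]; first by rewrite mxE.
rewrite /e; case: (j == 0); last case: (_ && _) => //.
  by apply: (regularD sX) => //; [apply: (regularX sX)|apply: (regularM sX)].
by apply: (regularB sX) => //; [apply: (regularN sX)|apply: (regularM sX)].
Qed.

End RegularCoordinates.

Local Notation hess_cell := (Hess (jordan_block K n) (@h2 n) `&` opposite_cell K n).

Definition flag_matrix (V : flag K n) : 'M[K]_n := \matrix_(i, j) chart_value i j V.

Lemma flag_matrix_col_flag A (uA : unitriangular A) :
  flag_matrix (col_flag (unitriangular_GL uA)) = A.
Proof. by apply/matrixP => i j; rewrite mxE chart_value_unitriangular. Qed.

Lemma unitriangular_GL_eq (A B : 'M[K]_n) (uA : unitriangular A) (uB : unitriangular B) :
  A = B -> unitriangular_GL uA = unitriangular_GL uB.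
Proof. by move=> AB; apply: val_inj. Qed.

(** The map to the quotient is built from a lift r to the plane that is
    chosen pointwise, flag by flag; it is a morphism because x, c and t are
    regular. *)
Lemma isomorphic_cyclic_singularity (zeta : K) m :
  n.-primitive_root zeta -> m = #|free_positions N| ->
  isomorphic (subspace hess_cell)
    (product (cyclic_singularity zeta) (affine_space K m)).
Proof.
move=> zeta_prim m_card; set X := subspace hess_cell.
set C := cyclic_singularity zeta.
have sX : sheaf_of_functions X by apply/induced_sheaf/flag_sheaf.
have sC : sheaf_of_functions C by apply/coinduced_sheaf/affine_sheaf.
have sA := affine_sheaf K m; have sCA := product_sheaf sC sA.
have oCA := openT sCA.
have rA i j : @regular _ X setT (fun V => flag_matrix (sval V) i j).
  apply: (eq_regular sX (g := fun V => chart_value i j (sval V))).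
  - exact: openT.
  - by move=> V _; rewrite mxE.
  - by apply: regular_cell_chart => V [].
have [rx rc rt] := regular_cell_coords sX rA.
have /choice[r rP] : forall V : X, exists w, [/\
    invariants n w 0 0 = cell_x (flag_matrix (sval V)),
    invariants n w 0 1 = cell_c (flag_matrix (sval V)) &
    invariants n w 0 (inord 2) = cell_t (flag_matrix (sval V))].
  move=> [V [/= hV /opposite_cellP[A [uA VE]]]]; apply: (invariants_surj zeta_prim).
  move: hV; rewrite VE flag_matrix_col_flag.
  by move=> /Hess_unitriangular[].
pose f (V : X) : product C (affine_space K m) :=
  (@orbit_proj K (affine_space K 2) (cyclic_act zeta) (r V),
   cell_free m_card (flag_matrix (sval V))).
pose inv (O : C) i := orbit_invariants n O 0 i.
have invE (O : C) : inv O 0 ^+ n = inv O 1 * inv O (inord 2).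
  by rewrite /inv /orbit_invariants !mxE inordK//= exprMn.
pose G (p : product C (affine_space K m)) : GL K n := unitriangular_GL
  (cell_matrix_unitriangular m_card (inv p.1 0) (inv p.1 1) (inv p.1 (inord 2)) p.2).
have GP p : hess_cell (col_flag (G p)).
  split; first exact/cell_matrix_Hess/invE.
  by apply/opposite_cellP; eexists; eexists.
pose g p : X := exist _ (col_flag (G p)) (GP p).
exists f, g; split.
- apply: (morphism_product sX).
    apply: (morphism_cyclic_singularity zeta_prim sX) => i.
    case: i => -[|[|[|//]]] lti.
    + apply: (eq_regular sX _ _ rx); first exact: openT.
      move=> V _; have [<- _ _] := rP V.
      by congr (invariants n _ _ _); apply: val_inj.
    + apply: (eq_regular sX _ _ rc); first exact: openT.
      move=> V _; have [_ <- _] := rP V.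
      by congr (invariants n _ _ _); apply: val_inj.
    + apply: (eq_regular sX _ _ rt); first exact: openT.
      move=> V _; have [_ _ <-] := rP V.
      by congr (invariants n _ _ _); apply: val_inj; rewrite /= inordK.
  apply: morphism_affine => // k.
  apply: (eq_regular sX _ _ (rA (free_position m_card k).1 (free_position m_card k).2)).
    exact: openT.
  by move=> V _; rewrite mxE.
- apply: (morphism_induced sCA).
  apply: (morphism_comp (Y := GL_space K n) (f := G)); last exact: morphism_coinduced.
  apply: (morphism_induced sCA); apply: (morphism_affine sCA) => k.
  case/mxvec_indexP: k => i j.
  have rinv l : @regular _ (product C (affine_space K m)) setT (fun p => inv p.1 l).
    apply: (regular_fst sC sA (a := fun O => inv O l)).
    exact: (regular_orbit_invariants zeta_prim).
  have rw l : @regular _ (product C (affine_space K m)) setT (fun p => p.2 0 l).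
    apply: (regular_snd sC sA (b := fun w : 'rV[K]_m => w 0 l)).
    apply/(affine_regularP _ (openT sA)) => v _; exists 'X_l, 1.
    by rewrite meval1 oner_neq0; split=> // w _; rewrite meval1 mulr1 mevalXU.
  apply: (eq_regular sCA _ _ (regular_cell_matrix sCA m_card i j
    (rinv 0) (rinv 1) (rinv (inord 2)) rw)) => // p _.
  by rewrite /= mxvecE.
- move=> V; have := rP V; case: V => V hV [x c t]; apply: eq_exist => /=.
  have [/= hessV oV] := hV; have [A [uA VE]] := (opposite_cellP V).1 oV.
  have FE : flag_matrix V = A by rewrite VE flag_matrix_col_flag.
  rewrite [RHS]VE /G; congr (col_flag _); apply: unitriangular_GL_eq.
  rewrite /inv !orbit_invariants_proj// x c t /= FE.
  by apply: (cell_matrix_coords m_card (uA := uA)); rewrite -VE.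
- move=> [O w]; have [x c t] := rP (g (O, w)).
  have FE : flag_matrix (sval (g (O, w))) = 
    cell_matrix m_card (inv O 0) (inv O 1) (inv O (inord 2)) w.
    exact: flag_matrix_col_flag.
  have [ex ec et] := cell_coords_cell_matrix m_card (inv O 0) (inv O 1) (inv O (inord 2)) w.
  rewrite /f FE; congr (_, _); last first.
    by apply/rowP => k; rewrite mxE cell_matrix_free.
  have [v OE] : exists v, O = @orbit_proj K (affine_space K 2) (cyclic_act zeta) v.
    by case: O {x c t FE ex ec et} => O [v vE]; exists v; apply: eq_exist.
  rewrite {2}OE; apply: (invariants_orbit zeta_prim).
  move: x c t; rewrite FE ex ec et /inv OE orbit_invariants_proj// => x c t.
  apply/rowP => -[[|[|[|//]]] lti].
  - by rewrite (_ : Ordinal lti = 0) ?x//; apply: val_inj.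
  - by rewrite (_ : Ordinal lti = 1) ?c//; apply: val_inj.
  - by rewrite (_ : Ordinal lti = inord 2) ?t//; apply: val_inj; rewrite /= inordK.
Qed.

End Assembly.

Theorem theorem1p4 (R : realType) (n : nat) (n_ge3 : (3 <= n)%N)
    (zeta : R[i]) (zeta_prim : n.-primitive_root zeta) :
  isomorphic
    (subspace (Hess (jordan_block R[i] n) (@h2 n) `&`
               opposite_cell R[i] n))
    (product (cyclic_singularity zeta)
             (affine_space R[i] (((n - 1) * (n - 2)) %/ 2 - 1))).
Proof.
case: n n_ge3 zeta_prim => [|[|[|N]]] // _ zeta_prim.
by apply: isomorphic_cyclic_singularity => //; rewrite card_free_positions.
Qed.
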